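(* In $\mathbb{CP}^2$ with homogeneous coordinates $[x:y:z]$, let $C$ be the conic $x^2+y^2+z^2-2xy-2xz-2yz=0$, and consider the lines $L_1: x+2y-4z=0$, $L_2: x=0$, $L_3: y=0$, $L_4: x-y+2z=0$, together with the two sets of three lines $$L^1_5: 2x+2y-5z=0,\quad L^1_6: x+7y-4z=0,\quad L^1_7: 2x-2y+z=0,$$ $$L^2_5: x+3y-7z=0,\quad L^2_6: x-4z=0,\quad L^2_7: x-y+5z=0.$$ Set $\mathcal{C}=C\cup L_1$ and, for $i\in\{1,2\}$, $\mathcal{B}^i=L_2\cup L_3\cup L_4\cup L^i_5\cup L^i_6\cup L^i_7$. Then there is no homeomorphism $h:\mathbb{CP}^2\to\mathbb{CP}^2$ such that $h(\mathcal{C}\cup\mathcal{B}^1)=\mathcal{C}\cup\mathcal{B}^2$.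
   Context: Here $\mathbb{CP}^2$ is the complex projective plane with its usual (Euclidean) topology, and curves are identified with their sets of complex points. Note that $C$ denotes the conic while $\mathcal{C}$ denotes the union of the conic and the line $L_1$. *)

(* Defs.v *)
From HB Require Import structures.
From mathcomp Require Import all_boot all_order all_algebra generic_quotient.
From mathcomp Require Import complex.
From mathcomp Require Import boolp classical_sets functions reals topology.
From mathcomp Require Import normedtype.

Set Implicit Arguments.
Unset Strict Implicit.
Unset Printing Implicit Defensive.

Import Order.TTheory GRing.Theory Num.Theory.
Import numFieldTopology.Exports.

Local Open Scope classical_set_scope.
Local Open Scope ring_scope.
Local Open Scope quotient_scope.

(* [R[i]^o] carries the topology of the balls of the modulus, i.e. the Euclidean
   topology. *)
HB.instance Definition _ (R : realType) :=
  PseudoPointedMetric.copy R[i] R[i]^o.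

Section ProjectivePlane.
Variable R : realType.

Definition homcoord : set 'rV[R[i]]_3 := [set v | v != 0].

(* [homcoord] used as a type has the topology induced by 'rV[R[i]]_3. *)
Definition proportional (u v : homcoord) : bool :=
  `[< exists2 a : R[i], a != 0 & val v = a *: val u >].

Lemma proportional_refl : reflexive proportional.
Proof. by move=> u; apply/asboolP; exists 1; rewrite ?oner_neq0 ?scale1r. Qed.

Lemma proportional_sym : symmetric proportional.
Proof.
suff H u v : proportional u v -> proportional v u by move=> u v; apply/idP/idP => /H.
move=> /asboolP[a a0 e]; apply/asboolP; exists a^-1; first by rewrite invr_eq0.
by rewrite e scalerA mulVf ?scale1r.
Qed.

Lemma proportional_trans : transitive proportional.
Proof.
move=> v u w /asboolP[a a0 ea] /asboolP[b b0 eb]; apply/asboolP; exists (b * a).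
  by rewrite mulf_neq0.
by rewrite eb ea scalerA.
Qed.

Canonical proportional_equiv :=
  EquivRel proportional proportional_refl proportional_sym proportional_trans.

Definition CP2 : Type := quotient_topology {eq_quot proportional_equiv}.

HB.instance Definition _ := Topological.on CP2.
HB.instance Definition _ := Quotient.on CP2.

Definition homogeneous_point (v : homcoord) : CP2 := \pi_CP2 v.

Lemma homogeneous_pointE (u v : homcoord) :
  homogeneous_point u = homogeneous_point v <->
  exists2 a : R[i], a != 0 & val v = a *: val u.
Proof.
split=> [e|/asboolP p].
  by apply/asboolP; apply/(@eqmodP _ proportional_equiv).
exact/(@eqmodP _ proportional_equiv).
Qed.

Definition coordinate (v : homcoord) (i : 'I_3) : R[i] :=
  (val v : 'rV[R[i]]_3) 0 i.

(* Meant for homogeneous F, in which case membership does not depend on the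
   homogeneous coordinates chosen: see [curveE]. *)
Definition curve (F : R[i] -> R[i] -> R[i] -> R[i]) : set CP2 :=
  homogeneous_point @`
    [set v | F (coordinate v 0) (coordinate v 1) (coordinate v 2) = 0].

Lemma curveE (F : R[i] -> R[i] -> R[i] -> R[i]) (d : nat) (v : homcoord) :
  (forall a x y z, F (a * x) (a * y) (a * z) = a ^+ d * F x y z) ->
  curve F (homogeneous_point v) <->
  F (coordinate v 0) (coordinate v 1) (coordinate v 2) = 0.
Proof.
move=> homF; split=> [|Fv]; last by exists v.
case=> u /= Fu /homogeneous_pointE[a _ e].
by rewrite /coordinate e !mxE homF Fu mulr0.
Qed.

End ProjectivePlane.

Definition homeomorphism (T U : topologicalType) (h : T -> U) : Prop :=
  exists g : U -> T,
    [/\ cancel h g, cancel g h, continuous h & continuous g].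

Unset Implicit Arguments.

Section Arrangements.
Variable R : realType.

Definition conic : set (CP2 R) :=
  curve (fun x y z =>
    x ^+ 2 + y ^+ 2 + z ^+ 2 - 2 * x * y - 2 * x * z - 2 * y * z).

Definition L1 : set (CP2 R) := curve (fun x y z => x + 2 * y - 4 * z).
Definition L2 : set (CP2 R) := curve (fun x y z => x).
Definition L3 : set (CP2 R) := curve (fun x y z => y).
Definition L4 : set (CP2 R) := curve (fun x y z => x - y + 2 * z).

(* [Lij] is the line L^i_j for j = 5, 6, 7. *)
Definition L15 : set (CP2 R) := curve (fun x y z => 2 * x + 2 * y - 5 * z).
Definition L16 : set (CP2 R) := curve (fun x y z => x + 7 * y - 4 * z).
Definition L17 : set (CP2 R) := curve (fun x y z => 2 * x - 2 * y + z).

Definition L25 : set (CP2 R) := curve (fun x y z => x + 3 * y - 7 * z).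
Definition L26 : set (CP2 R) := curve (fun x y z => x - 4 * z).
Definition L27 : set (CP2 R) := curve (fun x y z => x - y + 5 * z).

Definition conic_line : set (CP2 R) := conic `|` L1.

Definition B1 : set (CP2 R) := L2 `|` L3 `|` L4 `|` L15 `|` L16 `|` L17.
Definition B2 : set (CP2 R) := L2 `|` L3 `|` L4 `|` L25 `|` L26 `|` L27.

End Arrangements.

(* Main.v *)
Require Import Defs.
From mathcomp Require Import all_boot all_order all_algebra complex.
From mathcomp Require Import boolp classical_sets functions cardinality reals topology.
From mathcomp Require Import normedtype realfun.
From mathcomp Require Import ring lra.

Set Implicit Arguments.
Unset Strict Implicit.
Unset Printing Implicit Defensive.

Import Order.TTheory GRing.Theory Num.Theory.
Import numFieldTopology.Exports numFieldNormedType.Exports.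

Local Open Scope classical_set_scope.
Local Open Scope ring_scope.
Local Open Scope quotient_scope.

(** The invariant is the double cover of the plane branched along the six lines
of an arrangement [B]. Let [F] be the product of their linear forms. On the conic
every contact with [B] is either a tangency or a point common to two lines of [B],
and on [L1] the lines of [B] meet in pairs; so [F] is a square on the conic and,
up to a constant, a square on [L1]. The two square roots can be compared at the
nodes [N1] and [N2] where the conic meets [L1], and the question is whether the
two comparisons have the same sign: this is whether a loop running from [N1] to
[N2] along the conic and back along [L1] lifts to a closed loop of the double
cover. For the first arrangement the signs differ ([nodes_sign]).

For the second arrangement such a loop even bounds a disc in the complement of
the six lines. It is written down explicitly as [disc], by joining [N1] to the
points of an arc of the conic inside the complex lines that they span, and
[disc_avoids] checks that it misses [B]. If a homeomorphism [h] existed, its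
inverse [g] would carry this disc into the complement of the six lines of the
first arrangement, where [F], made into a function on the plane by dividing by the
sixth power of one of the forms, is continuous and never zero. A continuous
function without zeros on a square has a square root, so the roots on the conic
and on [L1] would agree at both nodes up to a common sign ([square_monodromy]),
which is the contradiction.

This needs [g] to map the conic, [L1] and the other six lines to the corresponding
curves. A line or a smooth conic remains arcwise connected when finitely many
points are avoided, so its image, outside the finitely many crossings, stays in one
component of the other union ([image_in_one_component]); hence [g] permutes
the components ([component_image]). Two lines share one point, while the conic
shares two with [L1] and with [L4], so the conic goes to the conic ([phi_conic]).
Among the lines, [L1] alone meets the conic in two points that lie on no
third component ([phi_L1]). *)

(** * Continuity of complex-valued functions *)

Section ComplexContinuity.
Variable R : realType.
Local Notation C := R[i].

Lemma real_complex_continuous : continuous (fun x : R => (x%:C)%C : C).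
Proof.
move=> x; apply/(@cvgrPdist_lt C C^o) => e e0.
have [e' ee e'0] : exists2 e' : R, e = (e'%:C)%C & 0 < e'.
  by case: e e0 => a b; rewrite ltcE /= => /andP[/eqP -> a0]; exists a.
near=> t.
rewrite -rmorphB /= normc_def /= expr0n /= addr0 sqrtr_sqr ee ltcR.
by near: t; apply: cvgr_dist_lt => //; exact: cvg_id.
Unshelve. all: by end_near. Qed.

Lemma Re_continuous : continuous (fun z : C => complex.Re z : R).
Proof.
move=> x; apply/(@cvgrPdist_lt R R^o C (nbhs x) (nbhs_filter x)) => e e0.
have e0C : 0 < (e%:C)%C :> C by rewrite ltcR.
apply: filterS (@nbhsx_ballx C C^o x _ e0C) => t.
rewrite -ball_normE /= => xt; rewrite -ltcR; apply: le_lt_trans xt.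
by apply: le_trans (normc_ge_Re _); case: (x) (t) => [? ?] [? ?].
Qed.

Section AtAPoint.
Variables (T : topologicalType).
Implicit Types f g : T -> C.

Lemma complex_continuousD f g x : {for x, continuous f} -> {for x, continuous g} ->
  {for x, continuous (fun t => f t + g t)}.
Proof. by move=> cf cg; exact: (@continuousD C C^o T f g x cf cg). Qed.

Lemma complex_continuousN f x : {for x, continuous f} -> {for x, continuous (fun t => - f t)}.
Proof. by move=> cf; exact: (@continuousN C C^o T f x cf). Qed.

Lemma complex_continuousM f g x : {for x, continuous f} -> {for x, continuous g} ->
  {for x, continuous (fun t => f t * g t)}.
Proof. by move=> cf cg; exact: (@continuousM C T f g x cf cg). Qed.

Lemma complex_continuousV f x : {for x, continuous f} -> f x != 0 ->
  {for x, continuous (fun t => (f t)^-1)}.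
Proof. by move=> cf f0; exact: (@continuousV C T f x f0 cf). Qed.

Lemma complex_continuous_cst (a : C) x : {for x, continuous (fun t : T => a)}.
Proof. exact: cst_continuous. Qed.

Lemma complex_continuousX f x n : {for x, continuous f} -> {for x, continuous (fun t => f t ^+ n)}.
Proof.
move=> cf; case: n => [|n]; first exact: complex_continuous_cst.
by elim: n => [//|n IH]; exact: (complex_continuousM cf IH).
Qed.

Lemma complex_continuous_norm f x : {for x, continuous f} -> {for x, continuous (fun t => `|f t|)}.
Proof.
move=> cf.
exact: (continuous_comp cf (@norm_continuous C C^o (f x))).
Qed.

Lemma complex_continuous_Re f x : {for x, continuous f} ->
  {for x, continuous (fun t => complex.Re (f t))}.
Proof. move=> cf. exact: (continuous_comp cf (@Re_continuous (f x))). Qed.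

Lemma complex_continuous_real (f : T -> R) x : {for x, continuous f} ->
  {for x, continuous (fun t => (f t)%:C%C)}.
Proof. move=> cf. exact: (continuous_comp cf (@real_complex_continuous (f x))). Qed.

Lemma near_neq0 f x : {for x, continuous f} -> f x != 0 -> \forall s \near x, f s != 0.
Proof.
move=> cf f0.
have o : open [set y : C | y != 0].
  have -> : [set y : C | y != 0] = ~` [set 0] by apply/seteqP; split => y /eqP.
  apply: (@closed_openC).
  exact: (@accessible_closed_set1 C^o (hausdorff_accessible (@norm_hausdorff C C^o))).
exact: (cf [set y | y != 0] (open_nbhs_nbhs (conj o f0))).
Qed.

Lemma row_continuous n (f : T -> 'I_n -> C) x : (forall j, {for x, continuous (f^~ j)}) ->
  {for x, continuous (fun t => \row_j f t j)}.
Proof.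
move=> cf A [P nP PA]; have : nbhs x [set t | forall j : 'I_n, P ord0 j (f t j)].
  apply: filter_forall => j; apply: (cf j); have := nP ord0 j; by rewrite mxE.
apply: filterS => t Pt. apply: PA => i j; rewrite mxE ord1; exact: Pt.
Qed.
End AtAPoint.

Lemma entry_continuous n (j : 'I_n) : continuous (fun v : 'rV[C]_n => v ord0 j).
Proof. exact: coord_continuous. Qed.
End ComplexContinuity.

(** * Points of the plane from homogeneous coordinates *)

Section HomogeneousCoordinates.
Variable R : realType.
Local Notation C := R[i].
Implicit Types x y z : C.

Definition vec x y z : 'rV[C]_3 := \row_j [:: x; y; z]`_j.
Definition nonzero x y z := [|| x != 0, y != 0 | z != 0].

Lemma vecE x y z : (vec x y z 0 0 = x) * (vec x y z 0 1 = y) * (vec x y z 0 2 = z).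
Proof. by rewrite !mxE. Qed.

Lemma vec_coord (v : 'rV[C]_3) : v = vec (v 0 0) (v 0 1) (v 0 2).
Proof.
by apply/rowP; case=> [[|[|[|//]]] ?]; rewrite mxE /=; congr (v _ _); apply/val_inj.
Qed.

Lemma vec_eq0 x y z : (vec x y z != 0) = nonzero x y z.
Proof.
apply/idP/idP => [|nz].
  apply: contraR; rewrite /nonzero !negb_or !negbK => /and3P[/eqP -> /eqP -> /eqP ->].
  apply/eqP/rowP => i; rewrite !mxE. by case: i => [[|[|[|]]]].
apply/eqP => e; move: nz; rewrite /nonzero.
have := vecE x y z; rewrite e !mxE => -[[<- <-] <-]. by rewrite eqxx.
Qed.

Lemma vec_in x y z : nonzero x y z -> vec x y z \in @homcoord R.
Proof. by move=> n; apply/mem_set; rewrite /homcoord /= vec_eq0. Qed.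

Lemma homcoord1_subproof : vec 1 0 0 \in @homcoord R.
Proof. by apply: vec_in; rewrite /nonzero oner_eq0. Qed.

Definition homcoord1 : @homcoord R := SigSub homcoord1_subproof.

Definition homvec x y z : @homcoord R := insubd homcoord1 (vec x y z).

Lemma homvecE x y z : nonzero x y z -> val (homvec x y z) = vec x y z.
Proof. by move=> n; rewrite /homvec insubdK ?vec_in. Qed.

(** A total function, so that maps into the plane can be written with formulas; at the
triple of zeros it takes a default value. *)
Definition pt x y z : CP2 R := homogeneous_point (homvec x y z).

Lemma pt_hom x y z (n : nonzero x y z) : pt x y z = homogeneous_point (SigSub (vec_in n)).
Proof. by rewrite /pt; congr homogeneous_point; apply/val_inj; rewrite homvecE. Qed.

Lemma hom_pt (v : @homcoord R) :
  homogeneous_point v = pt (coordinate v 0) (coordinate v 1) (coordinate v 2) /\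
  nonzero (coordinate v 0) (coordinate v 1) (coordinate v 2).
Proof.
have n : nonzero (coordinate v 0) (coordinate v 1) (coordinate v 2).
  rewrite -vec_eq0 -vec_coord. exact: (set_mem (valP v)).
split => //. rewrite (pt_hom n); congr homogeneous_point; apply/val_inj => /=. exact: vec_coord.
Qed.

Lemma pt_surj (p : CP2 R) : exists x y z, nonzero x y z /\ p = pt x y z.
Proof.
elim/quotW: p => v. have [e n] := hom_pt v.
by exists (coordinate v 0), (coordinate v 1), (coordinate v 2).
Qed.

Lemma pt_eqP x y z x' y' z' : nonzero x y z -> nonzero x' y' z' ->
  pt x y z = pt x' y' z' <-> exists2 a, a != 0 & [/\ x' = a * x, y' = a * y & z' = a * z].
Proof.
move=> n n'; rewrite !pt_hom homogeneous_pointE /=; split => -[a a0].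
  move=> e; exists a => //.
  have ej j := congr1 (fun v : 'rV_3 => v 0 j) e.
  by split; [have := ej 0|have := ej 1|have := ej 2]; rewrite /= !mxE.
move=> [-> -> ->]; exists a => //. apply/rowP=> i; rewrite !mxE. by case: i => [[|[|[|]]]].
Qed.

Lemma curve_pt F d x y z : (forall a x y z, F (a * x) (a * y) (a * z) = a ^+ d * F x y z) ->
  nonzero x y z -> curve F (pt x y z) <-> F x y z = 0.
Proof.
by move=> h n; rewrite pt_hom (curveE _ h) /coordinate /= !vecE. Qed.

(** Where one coordinate is nonzero it stays so nearby, and there the default value of
[pt] does not interfere. *)
Lemma pt_continuous (T : topologicalType) (f g k : T -> C) t :
  {for t, continuous f} -> {for t, continuous g} -> {for t, continuous k} ->
  nonzero (f t) (g t) (k t) -> {for t, continuous (fun s => pt (f s) (g s) (k s))}.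
Proof.
move=> cf cg ck n.
have cv : {for t, continuous (fun s => vec (f s) (g s) (k s))}.
  have H (j : 'I_3) : {for t, continuous (fun s => [:: f s; g s; k s]`_j)}.
    case: j => [[|[|[|k']]] kj]; [exact: cf | exact: cg | exact: ck |].
    exact: (False_ind _ (notF kj)).
  exact: (@row_continuous R T 3 (fun s j => [:: f s; g s; k s]`_j) t H).
have nn : \forall s \near t, nonzero (f s) (g s) (k s).
  case/or3P: n => n; [have := near_neq0 cf n|have := near_neq0 cg n|have := near_neq0 ck n];
    apply: filterS => s; rewrite /nonzero => ->; rewrite ?orbT //.
suff ci : {for t, continuous (fun s => homvec (f s) (g s) (k s))}.
  exact: (continuous_comp ci (@pi_continuous _ _ _)).
move=> A [_ [[V oV <-] Vt VA]].
have : nbhs t ((fun s => vec (f s) (g s) (k s)) @^-1` V).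
  apply: (cv V); apply: open_nbhs_nbhs; split => //.
  by move: Vt; rewrite /= set_valE homvecE.
by apply: filterS2 nn => s ns Vs; apply: VA; rewrite /= set_valE homvecE.
Qed.
End HomogeneousCoordinates.

(** Continuity at a point is handled syntactically, one operation at a time: letting
unification find the arguments would unfold the filters behind the notation. *)
Ltac complex_continuity := repeat lazymatch goal with
  | |- continuous_at ?x ?f => change {for x, continuous f}
  | |- {for _, continuous (fun t => t)} => exact: cvg_id
  | |- {for _, continuous (fun t => @?f t + @?g t)} =>
    refine (complex_continuousD (f := f) (g := g) _ _)
  | |- {for _, continuous (fun t => - @?f t)} => refine (complex_continuousN (f := f) _)
  | |- {for _, continuous (fun t => @?f t * @?g t)} =>
    refine (complex_continuousM (f := f) (g := g) _ _)
  | |- {for _, continuous (fun t => @?f t ^+ ?n)} =>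
    refine (complex_continuousX (f := f) (n := n) _)
  | |- {for _, continuous (fun t => (@?f t)^-1)} => refine (complex_continuousV (f := f) _ _);
    cbv beta
  | |- {for _, continuous (fun t => ((@?f t)%:C)%C)} => refine (complex_continuous_real (f := f) _)
  | |- {for _, continuous (fun t => fun_of_matrix t _ _)} => exact: entry_continuous
  | |- {for _, continuous (fun t => ?a)} => exact: complex_continuous_cst
  end.

(** * Functions and closed sets of the plane *)

Section PlaneFunctions.
Variable R : realType.
Local Notation C := R[i].
Implicit Types x y z : C.
Implicit Types G F : C -> C -> C -> C.

(** Well defined on the plane, independently of the representatives, when [G] is
homogeneous of degree zero. *)
Definition descend G (p : CP2 R) : C :=
  G (coordinate (repr p) 0) (coordinate (repr p) 1) (coordinate (repr p) 2).

(** The condition [a != 0] lets quotients of forms qualify, with the convention that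
dividing by zero gives zero. *)
Definition homog0 G := forall a x y z, a != 0 -> G (a * x) (a * y) (a * z) = G x y z.
Definition homog d G := forall a x y z, G (a * x) (a * y) (a * z) = a ^+ d * G x y z.

Lemma descend_hom G (v : @homcoord R) : homog0 G ->
  descend G (homogeneous_point v) = G (coordinate v 0) (coordinate v 1) (coordinate v 2).
Proof.
move=> dG; rewrite /descend; set w := repr _.
have : homogeneous_point v = homogeneous_point w by rewrite /homogeneous_point reprK.
move=> /homogeneous_pointE[a a0 e]; rewrite /coordinate e !mxE. exact: dG.
Qed.

Lemma descend_pt G x y z : homog0 G -> nonzero x y z -> descend G (pt x y z) = G x y z.
Proof. by move=> dG n; rewrite /pt descend_hom // /coordinate homvecE // !vecE. Qed.

(** The plane is a quotient, so a set is open as soon as its preimage is; the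
preimages used here live over the affine chart [x != 0], which is where quotients with
denominator a power of [x] are continuous. *)
Lemma descend_continuous G x y z : homog0 G -> x != 0 ->
  (forall v : 'rV[C]_3, v 0 0 != 0 ->
    {for v, continuous (fun v : 'rV[C]_3 => G (v 0 0) (v 0 1) (v 0 2))}) ->
  {for pt x y z, continuous (descend G)}.
Proof.
move=> dG x0 cG A; rewrite nbhsE /= => -[B [oB BG] BA].
pose W : set 'rV[C]_3 := [set v | v 0 0 != 0 /\ B (G (v 0 0) (v 0 1) (v 0 2))].
have n : nonzero x y z by rewrite /nonzero x0.
have oW : open W.
  rewrite openE => v [v0 Bv]. apply: filterI.
    exact: (near_neq0 (@entry_continuous R 3 0 v) v0).
  exact: (cG v v0 B (open_nbhs_nbhs (conj oB Bv))).
(* The first condition expresses that the coordinate x does not vanish, as a function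
   of degree zero. *)
pose U : set (CP2 R) := [set p | descend (fun x y z => if x == 0 then 0 else 1) p != 0 /\
  B (descend G p)].
have UE (v : @homcoord R) : U (homogeneous_point v) <-> W (val v).
  rewrite /U /= !descend_hom //; last by move=> a x' y' z' a0; rewrite mulf_eq0 (negbTE a0).
  rewrite /W /= /coordinate; case: (val v 0 0 == 0) => /=; by rewrite ?eqxx ?oner_eq0.
apply: filterS (fun p (Up : U p) => BA _ (proj2 Up)) _.
apply: open_nbhs_nbhs; split.
  rewrite /open /= /quotient_open.
  have -> : \pi_(quotient_topology {eq_quot @proportional_equiv R}) @^-1` U = set_val @^-1` W.
    by apply/seteqP; split => v; have [h1 h2] := UE v.
  exists W => //.
by apply/UE; rewrite homvecE //; split; rewrite /= !vecE //; move: BG; rewrite /= descend_pt.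
Qed.

Lemma curve_closed F d : homog d F ->
  (forall v : 'rV[C]_3, {for v, continuous (fun v : 'rV[C]_3 => F (v 0 0) (v 0 1) (v 0 2))}) ->
  closed (curve F : set (CP2 R)).
Proof.
move=> hF cF; rewrite -openC.
pose W : set 'rV[C]_3 := [set v | F (v 0 0) (v 0 1) (v 0 2) != 0].
have oW : open W by rewrite openE => v Wv; exact: (near_neq0 (cF v) Wv).
rewrite /open /= /quotient_open.
have -> : \pi_(quotient_topology {eq_quot @proportional_equiv R}) @^-1` (~` (curve F)) = set_val
  @^-1` W; last by exists W.
apply/seteqP; split => v /=.
  by move=> h; apply/eqP => Fv; apply: h; apply/(curveE v hF).
by move=> /eqP h /(curveE v hF).
Qed.
End PlaneFunctions.

(** * Images of curves that no finite set disconnects *)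

Section Arcs.
Variable R : realType.

(** The topological feature of a sphere that is needed: two of its points are joined
by an arc that avoids any prescribed finite set, except possibly at its ends. *)
Definition robustly_arc_connected (T : topologicalType) (X : set T) :=
  forall a b, X a -> X b -> a <> b -> forall S : set T, finite_set S ->
  exists p : R -> T, [/\ continuous p, p 0 = a, p 1 = b &
    forall t, 0 < t < 1 -> X (p t) /\ ~ S (p t)].

Lemma closed_arc_ends (T : topologicalType) (A : set T) (p : R -> T) : closed A -> continuous p ->
  (forall t, 0 < t < 1 -> A (p t)) -> A (p 0) /\ A (p 1).
Proof.
move=> cA cp pA.
have cB : closed (p @^-1` A) by apply: closed_comp => // ? _; exact: cp.
have H (x : R) : (forall e, 0 < e -> exists2 t, 0 < t < 1 & `|x - t| < e) -> A (p x).
  move=> h; apply: cB => B /(@nbhs_ballP R R^o) [e /= e0 eB].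
  have [t t01 xt] := h e e0. exists t; split; first exact: pA.
  exact: eB.
split; apply: H => e e0.
- exists (Num.min e 1 / 2); first by case: (ltP e 1) => ? ; lra.
  rewrite sub0r normrN ger0_norm; last by case: (ltP e 1) => ? ; lra.
  by case: (ltP e 1) => ?; lra.
- exists (1 - Num.min e 1 / 2); first by case: (ltP e 1) => ? ; lra.
  rewrite opprB addrC subrK ger0_norm; last by case: (ltP e 1) => ? ; lra.
  by case: (ltP e 1) => ?; lra.
Qed.

(** The open interval is connected, and the preimages of the finitely many closed sets
partition it into closed pieces. *)
Lemma arc_in_component (T : topologicalType) (J : finType) (Y : J -> set T) (p : R -> T) j :
  continuous p -> (forall j, closed (Y j)) ->
  (forall t, 0 < t < 1 -> exists k, Y k (p t)) ->
  (forall t k l, 0 < t < 1 -> Y k (p t) -> Y l (p t) -> k = l) ->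
  (exists2 t, 0 < t < 1 & Y j (p t)) ->
  forall t, 0 < t < 1 -> Y j (p t).
Proof.
move=> cp cY pY inj [t0 t01 Yt0].
pose E : set R := `]0, 1[%classic.
have Eq t : E t <-> 0 < t < 1 by rewrite /E /= in_itv.
have : connected E by apply/connected_intervalP; exact: interval_is_interval.
move=> /(_ (E `&` p @^-1` Y j)) h.
suff e : E `&` p @^-1` Y j = E
  by move=> t /Eq Et; have [] : (E `&` p @^-1` Y j) t by rewrite e.
apply: h.
- by exists t0; split => //; apply/Eq.
- exists (~` (p @^-1` \bigcup_(k in [set k | k != j]) Y k)).
    rewrite openC; apply: closed_comp => [? _|]; first exact: cp.
    apply: closed_bigcup => //. exact: finite_finset.
  apply/seteqP; split => t [Et] Yt; split => //.
    move=> [k /= kj Yk]; move/Eq: Et => Et. by rewrite (inj _ _ _ Et Yk Yt) eqxx in kj.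
  move/Eq: (Et) => /pY [k Yk]; have [<- //|kj] := eqVneq k j.
  by case: Yt; exists k.
- exists (p @^-1` Y j) => //. by apply: closed_comp => // ? _; exact: cp.
Qed.

(** Arcs are chosen to avoid the preimages of the finitely many points that lie on two
of the [Y j]. The interior of such an arc stays in a single [Y j], and so do its ends
because [Y j] is closed. Starting all arcs at a point [c] whose image lies on only one
[Y j] makes this [j] the same for every end. *)
Lemma image_in_one_component (T U : topologicalType) (J : finType)
    (X : set T) (Y : J -> set U) (g : T -> U) a b :
  continuous g -> injective g -> robustly_arc_connected X -> X a -> X b -> a <> b ->
  (forall j, closed (Y j)) -> (forall j k, j != k -> finite_set (Y j `&` Y k)) ->
  (forall x, X x -> exists j, Y j (g x)) ->
  exists j, forall x, X x -> Y j (g x).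
Proof.
move=> cg ig aX Xa Xb ab cY fY gX.
pose S : set U := \bigcup_(jk in [set jk : J * J | jk.1 != jk.2]) (Y jk.1 `&` Y jk.2).
have fS : finite_set (g @^-1` S).
  apply: finite_preimage; first by move=> ? ? _ _; exact: ig.
  apply: bigcup_finite => [|jk]; [exact: finite_finset|exact: fY].
have Sinj x k l : ~ S (g x) -> Y k (g x) -> Y l (g x) -> k = l.
  move=> nS Yk Yl; apply/eqP/negP => /negP kl; apply: nS. by exists (k, l).
have [c Xc nSc] : exists2 c, X c & ~ S (g c).
  have [p [_ _ _ /(_ (1/2))]] := aX a b Xa Xb ab _ fS.
  by case; [lra|exists (p (1/2))].
have [j Yc] := gX c Xc; exists j => x Xx.
have [<- //|/eqP cx] := eqVneq c x.
have [p [cp p0 p1 pX]] := aX c x Xc Xx cx _ fS.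
have cgp : continuous (g \o p) by move=> t; exact: (continuous_comp (cp t) (@cg (p t))).
have hX t (h : 0 < t < 1) := proj1 (pX t h).
have [k Yk] := gX _ (hX (1/2) ltac:(lra)).
have A : forall t, 0 < t < 1 -> Y k ((g \o p) t).
  apply: (@arc_in_component _ J Y (g \o p)) => //.
  - by move=> t /hX /gX.
  - move=> t u v /pX [_ ?]; exact: Sinj.
  - by exists (1/2) => //; lra.
have [] := @closed_arc_ends _ (Y k) (g \o p) (cY k) cgp A.
rewrite /= p0 p1 => Ykc. by rewrite (Sinj _ _ _ nSc Yc Ykc).
Qed.

End Arcs.

(** * Arcs in curves parametrized by the projective line *)

Section ParametrizedArcs.
Variable R : realType.
Local Notation C := R[i].
Implicit Types s t x y z : C.

(** The arcs [t |-> (1 - t, t + i n t (1 - t))], for [n] a natural number, meet only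
at their ends: the real part of the ratio of the coordinates determines [t], and then
the imaginary part determines [n]. So a finite set misses all but finitely many of
them. *)
Lemma param_arc (Phi : C -> C -> CP2 R) (S : set (CP2 R)) :
  (forall f g : R -> C, continuous f -> continuous g ->
     (forall r, (f r != 0) || (g r != 0)) -> continuous (fun r => Phi (f r) (g r))) ->
  (forall s t s' t', (s != 0) || (t != 0) -> (s' != 0) || (t' != 0) ->
     Phi s t = Phi s' t' -> s * t' = s' * t) ->
  finite_set S ->
  exists p : R -> CP2 R, [/\ continuous p, p 0 = Phi 1 0, p 1 = Phi 0 1 &
    forall r, 0 < r < 1 -> (exists s t, ((s != 0) || (t != 0)) /\ p r = Phi s t) /\ ~ S (p r)].
Proof.
move=> cPhi iPhi fS.
pose f (r : R) : C := ((1 - r)%:C)%C.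
pose g (n : nat) (r : R) : C := (r +i* (n%:R * r * (1 - r)))%C.
have gE n r : g n r = (r%:C)%C + 'i%C * ((n%:R * r * (1 - r))%:C)%C.
  by rewrite /g [LHS]complexE.
have nz n r : (f r != 0) || (g n r != 0).
  rewrite /f /g !eq_complex /= -negb_and; apply/negP => /andP[/andP[/eqP h1 _] /andP[/eqP h2 _]].
  lra.
have cf : continuous f.
  move=> r; rewrite (_ : f = fun r => 1 - (r%:C)%C); last by apply/funext => ?; rewrite /f rmorphB.
  complex_continuity.
have cg n : continuous (g n).
  move=> r; rewrite (_ : g n = fun r => (r%:C)%C + 'i%C * (n%:R * (r%:C)%C * (1 - (r%:C)%C)));
    last first.
    by apply/funext => ?; rewrite gE !rmorphM rmorphB rmorph_nat.
  complex_continuity.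
pose p n r := Phi (f r) (g n r).
have f0 : f 0 = 1 by rewrite /f subr0.
have f1 : f 1 = 0 by rewrite /f subrr.
have g0 n : g n 0 = 0 by rewrite /g mulr0 mul0r.
have g1 n : g n 1 = 1 by rewrite /g subrr mulr0.
suff [n pn] : exists n, forall r, 0 < r < 1 -> ~ S (p n r).
  exists (p n); split.
  - exact: (cPhi f (g n) cf (cg n) (nz n)).
  - by rewrite /p f0 g0.
  - by rewrite /p f1 g1.
  move=> r r01; split; last exact: pn. by exists (f r), (g n r).
apply: contrapT => /forallNP H.
have {}H n : exists r, 0 < r < 1 /\ S (p n r).
  by have /existsNP[r /not_implyP[? /contrapT ?]] := H n; exists r.
have [r rP] := choice H.
have inj : injective (fun n => p n (r n)).
  move=> n m /(iPhi _ _ _ _ (nz _ _) (nz _ _)).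
  have := proj1 (rP n); have := proj1 (rP m).
  rewrite /f /g; move: (r n) (r m) => u v v01 u01.
  rewrite mulrC [RHS]mulrC /= => /eqP; rewrite eq_complex /= => /andP[/eqP e1 /eqP e2].
  have uv : u = v by lra.
  move: e2; rewrite uv !mulr0 !add0r => e2.
  have w0 : v * (1 - v) * (1 - v) != 0 by rewrite !mulf_neq0 //; apply/eqP; lra.
  apply/eqP; rewrite -(eqr_nat R); apply/eqP; apply: (mulIf w0). lra.
apply: infinite_nat; apply: (@sub_finite_set _ _ ((fun n => p n (r n)) @^-1` S)).
  by move=> n _; exact: (proj2 (rP n)).
by apply: finite_preimage => // ? ? _ _; exact: inj.
Qed.
End ParametrizedArcs.

(** * Lines *)

Section Lines.
Variable R : realType.
Local Notation C := R[i].
Implicit Types a b c s t x y z : C.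

Lemma pt_eq_cross x y z x' y' z' : nonzero x y z -> nonzero x' y' z' ->
  x * y' = x' * y -> y * z' = y' * z -> x * z' = x' * z -> pt x y z = pt x' y' z'.
Proof.
move=> n n' e1 e2 e3; apply/(pt_eqP n n').
have key : exists2 l, x' = l * x & (y' = l * y /\ z' = l * z).
  case/or3P: (n) => h; [exists (x' / x)|exists (y' / y)|exists (z' / z)]; rewrite ?divfK //.
  - by split; apply: (mulIf h); rewrite mulrAC divfK // mulrC ?e1 ?e3.
  - by apply: (mulIf h); rewrite mulrAC divfK // -e1 mulrC.
  - by split=> //; apply: (mulIf h); rewrite mulrAC divfK // mulrC e2.
  - by apply: (mulIf h); rewrite mulrAC divfK // -e3 mulrC.
  - by split=> //; apply: (mulIf h); rewrite mulrAC divfK // -e2 mulrC.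
case: key => l ex [ey ez]; exists l => //.
by apply/eqP => l0; move: n'; rewrite /nonzero ex ey ez l0 !mul0r eqxx.
Qed.

Definition line a b c : set (CP2 R) := curve (fun x y z => a * x + b * y + c * z).

Lemma line_homog a b c : homog 1 (fun x y z => a * x + b * y + c * z).
Proof. by move=> k x y z; ring. Qed.

Lemma linePt a b c x y z : nonzero x y z -> line a b c (pt x y z) <-> a * x + b * y + c * z = 0.
Proof. exact: (curve_pt (@line_homog a b c)). Qed.

Lemma line_closed a b c : closed (line a b c).
Proof.
apply: (@curve_closed R _ 1 (@line_homog a b c)) => v; complex_continuity.
Qed.

(** The two forms have a one-dimensional common kernel, spanned by the cross product
of their coefficients. *)
Lemma line_line a b c a' b' c' p :
  nonzero (b * c' - c * b') (c * a' - a * c') (a * b' - b * a') ->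
  line a b c p -> line a' b' c' p -> p = pt (b * c' - c * b') (c * a' - a * c') (a * b' - b * a').
Proof.
move=> n; have [x [y [z [m ->]]]] := pt_surj p.
move=> /(linePt _ _ _ m) e1 /(linePt _ _ _ m) e2; apply: pt_eq_cross => //; apply/eqP;
  rewrite -subr_eq0.
- have -> : x * (c * a' - a * c') - (b * c' - c * b') * y =
    c * (a' * x + b' * y + c' * z) - c' * (a * x + b * y + c * z) by ring.
  by rewrite e1 e2 !mulr0 subr0.
- have -> : y * (a * b' - b * a') - (c * a' - a * c') * z =
    a * (a' * x + b' * y + c' * z) - a' * (a * x + b * y + c * z) by ring.
  by rewrite e1 e2 !mulr0 subr0.
- have -> : x * (a * b' - b * a') - (b * c' - c * b') * z =
    b' * (a * x + b * y + c * z) - b * (a' * x + b' * y + c' * z) by ring.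
  by rewrite e1 e2 !mulr0 subr0.
Qed.

(** Two distinct points of a line parametrize it by the combinations of their
coordinates. *)
Lemma line_robustly_arc_connected a b c : robustly_arc_connected R (line a b c).
Proof.
move=> p q; have [x [y [z [m ->]]]] := pt_surj p; have [x' [y' [z' [m' ->]]]] := pt_surj q.
move=> /(linePt _ _ _ m) e1 /(linePt _ _ _ m') e2 pq S fS.
have ind s t : [&& s * x + t * x' == 0, s * y + t * y' == 0 & s * z + t * z' == 0] ->
  s = 0 /\ t = 0.
  move=> /and3P[/eqP h1 /eqP h2 /eqP h3].
  have [s0|s0] := eqVneq s 0.
    split => //; apply/eqP/negP => /negP t0; move: h1 h2 h3;
      rewrite s0 !mul0r !add0r => /eqP h1 /eqP h2 /eqP h3.
    by move: m'; rewrite /nonzero; move: h1 h2 h3; rewrite !mulf_eq0 (negbTE t0) /= => -> -> ->.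
  exfalso; apply: pq; apply: pt_eq_cross => //; apply: (mulfI s0).
  - have -> : s * (x * y') = (s * x + t * x') * y' - t * x' * y' by ring.
    rewrite h1. have -> : s * (x' * y) = (s * y + t * y') * x' - t * x' * y' by ring.
    by rewrite h2 !mul0r.
  - have -> : s * (y * z') = (s * y + t * y') * z' - t * y' * z' by ring.
    rewrite h2. have -> : s * (y' * z) = (s * z + t * z') * y' - t * y' * z' by ring.
    by rewrite h3 !mul0r.
  - have -> : s * (x * z') = (s * x + t * x') * z' - t * x' * z' by ring.
    rewrite h1. have -> : s * (x' * z) = (s * z + t * z') * x' - t * x' * z' by ring.
    by rewrite h3 !mul0r.
have nz s t : (s != 0) || (t != 0) -> nonzero (s * x + t * x') (s * y + t * y') (s * z + t * z').
  rewrite -negb_and; apply: contraR; rewrite /nonzero !negb_or !negbK => /ind [-> ->].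
  by rewrite eqxx.
pose Phi s t := pt (s * x + t * x') (s * y + t * y') (s * z + t * z').
have [] := @param_arc R Phi S _ _ fS.
- move=> f g cf cg nfg r.
  have cf' : {for r, continuous f} := cf r. have cg' : {for r, continuous g} := cg r.
  refine (@pt_continuous R R (fun r => f r * x + g r * x') (fun r => f r * y + g r * y')
    (fun r => f r * z + g r * z') r _ _ _ (nz _ _ (nfg r))); complex_continuity;
    lazymatch goal with |- context [f] => exact: cf' | |- context [g] => exact: cg' end.
- move=> s t s' t' n n' /(pt_eqP (nz _ _ n) (nz _ _ n')) [l l0 [h1 h2 h3]].
  have [] := @ind (l * s - s') (l * t - t').
    by apply/and3P; split; apply/eqP;
      rewrite mulrBl [X in _ + X]mulrBl addrACA -opprD -?(h1,h2,h3) -!mulrA -mulrDr ?(h1,h2,h3)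
      subrr.
  move=> /eqP; rewrite subr_eq0 => /eqP <- /eqP;
    rewrite subr_eq0 => /eqP <-. by rewrite mulrCA mulrA.
- move=> f [cf f0 f1 fX]; exists f; split => //.
  + by rewrite f0 /Phi !mul1r !mul0r !addr0.
  + by rewrite f1 /Phi !mul1r !mul0r !add0r.
  + move=> r /fX[[s [t [n ->]]] nS]; split => //; apply/linePt; first exact: nz.
    have -> : a * (s * x + t * x') + b * (s * y + t * y') + c * (s * z + t * z') =
       s * (a * x + b * y + c * z) + t * (a * x' + b * y' + c * z') by ring.
    by rewrite e1 e2 !mulr0 addr0.
Qed.

End Lines.

(** * The conic *)

Section Conic.
Variable R : realType.
Local Notation C := R[i].
Implicit Types a b c s t x y z : C.

Definition conic_form x y z := x ^+ 2 + y ^+ 2 + z ^+ 2 - 2 * x * y - 2 * x * z - 2 * y * z.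

Lemma conic_homog : homog 2 conic_form.
Proof. by move=> k x y z; rewrite /conic_form; ring. Qed.

Lemma conicPt x y z : nonzero x y z -> conic R (pt x y z) <-> conic_form x y z = 0.
Proof. exact: (curve_pt conic_homog). Qed.

Lemma conic_closed : closed (conic R).
Proof. by apply: (@curve_closed R _ 2 conic_homog) => v; rewrite /conic_form; complex_continuity.
Qed.

(** The conic is the set where a choice of square roots of [x], [y], [z] satisfies
[sqrt x + sqrt y = sqrt z]. *)
Definition conic_point s t : CP2 R := pt (s ^+ 2) (t ^+ 2) ((s + t) ^+ 2).

Lemma conic_point_nonzero s t : (s != 0) || (t != 0) -> nonzero (s ^+ 2) (t ^+ 2) ((s + t) ^+ 2).
Proof. by rewrite /nonzero !sqrf_eq0 => /orP[->|->]; rewrite ?orbT. Qed.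

Lemma conic_point_on_conic s t : (s != 0) || (t != 0) -> conic R (conic_point s t).
Proof. by move=> n; apply/(conicPt (conic_point_nonzero n)); rewrite /conic_form; ring. Qed.

(** The conic is [(z - x - y)^2 = 4 x y], so [z - x - y] is twice the product of a
square root of [x] and one of [y]. *)
Lemma conic_has_param p : conic R p -> exists s t, ((s != 0) || (t != 0)) /\ p = conic_point s t.
Proof.
have [x [y [z [n ->]]]] := pt_surj p => /(conicPt n) e.
have main s t : s ^+ 2 = x -> t ^+ 2 = y -> z - x - y = 2 * (s * t) ->
   exists s t, ((s != 0) || (t != 0)) /\ pt x y z = conic_point s t.
  move=> sx ty st; exists s, t.
  have ez : z = (s + t) ^+ 2.
    by rewrite sqrrD sx ty -mulr_natl -st; ring.
  split; last by rewrite /conic_point sx ty ez.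
  move: n; rewrite /nonzero ez -sx -ty !sqrf_eq0; case: eqP => //= ->; case: eqP => //= ->.
  by rewrite addr0 eqxx.
have : (z - x - y - 2 * (sqrtC x * sqrtC y)) * (z - x - y + 2 * (sqrtC x * sqrtC y)) = 0.
  have -> : (z - x - y - 2 * (sqrtC x * sqrtC y)) * (z - x - y + 2 * (sqrtC x * sqrtC y)) =
    (z - x - y) ^+ 2 - 4 * (sqrtC x ^+ 2 * sqrtC y ^+ 2) by ring.
  by rewrite !sqrtCK -e /conic_form; ring.
move=> /eqP; rewrite mulf_eq0 => /orP[|]; rewrite ?subr_eq0 ?addr_eq0 => /eqP h.
  by apply: (main _ _ (sqrtCK x) (sqrtCK y)).
by apply: (main _ (- sqrtC y) (sqrtCK x)); rewrite ?sqrrN ?sqrtCK // h; ring.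
Qed.

(** The three coordinates determine [s^2], [t^2] and [s t] up to a common factor, and
hence the discriminant [(s t' - s' t)^2]. *)
Lemma conic_point_inj s t s' t' : (s != 0) || (t != 0) -> (s' != 0) || (t' != 0) ->
  conic_point s t = conic_point s' t' -> s * t' = s' * t.
Proof.
move=> n n' /(pt_eqP (conic_point_nonzero n) (conic_point_nonzero n')) [l l0 [h1 h2 h3]].
have h4 : s' * t' = l * (s * t).
  have two : (2 : C) != 0 by rewrite pnatr_eq0.
  apply: (mulfI two).
  have -> : 2 * (s' * t') = (s' + t') ^+ 2 - s' ^+ 2 - t' ^+ 2 by ring.
  by rewrite h1 h2 h3; ring.
apply/eqP; rewrite -subr_eq0 -sqrf_eq0; apply/eqP.
have -> : (s * t' - s' * t) ^+ 2 =
  s ^+ 2 * t' ^+ 2 + t ^+ 2 * s' ^+ 2 - 2 * (s * t) * (s' * t') by ring.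
by rewrite h1 h2 h4; ring.
Qed.

Lemma conic_point_eq s t s' t' : (s != 0) || (t != 0) -> (s' != 0) || (t' != 0) ->
  s * t' = s' * t -> conic_point s t = conic_point s' t'.
Proof.
move=> n n' e; apply: (pt_eq_cross (conic_point_nonzero n) (conic_point_nonzero n')).
- by rewrite -!exprMn e.
- have -> : t ^+ 2 * (s' + t') ^+ 2 = (s' * t + t * t') ^+ 2 by ring.
  by rewrite -e; ring.
- have -> : s ^+ 2 * (s' + t') ^+ 2 = (s * s' + s * t') ^+ 2 by ring.
  by rewrite e; ring.
Qed.

Lemma conic_robustly_arc_connected : robustly_arc_connected R (conic R).
Proof.
move=> p q /conic_has_param[a [b [n ->]]] /conic_has_param[a' [b' [n' ->]]] pq S fS.
have det : a * b' - a' * b != 0.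
  by apply/eqP => /eqP; rewrite subr_eq0 => /eqP e; apply: pq; exact: conic_point_eq.
pose Phi s t := conic_point (s * a + t * a') (s * b + t * b').
have nz s t : (s != 0) || (t != 0) -> (s * a + t * a' != 0) || (s * b + t * b' != 0).
  rewrite -!negb_and; apply: contra => /andP[/eqP h1 /eqP h2].
  apply/andP; split; rewrite -(mulIr_eq0 _ (mulIf det)); apply/eqP.
    have -> : s * (a * b' - a' * b) = (s * a + t * a') * b' - (s * b + t * b') * a' by ring.
    by rewrite h1 h2 !mul0r subrr.
  have -> : t * (a * b' - a' * b) = (s * b + t * b') * a - (s * a + t * a') * b by ring.
  by rewrite h1 h2 !mul0r subrr.
have [] := @param_arc R Phi S _ _ fS.
- move=> f g cf cg nfg r.
  have cf' : {for r, continuous f} := cf r. have cg' : {for r, continuous g} := cg r.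
  refine (@pt_continuous R R (fun r => (f r * a + g r * a') ^+ 2) (fun r =>
    (f r * b + g r * b') ^+ 2)
    (fun r => (f r * a + g r * a' + (f r * b + g r *
      b')) ^+ 2) r _ _ _ (conic_point_nonzero (nz _ _ (nfg r)))); complex_continuity;
    lazymatch goal with |- context [f] => exact: cf' | |- context [g] => exact: cg' end.
- move=> s t s' t' m m' /(conic_point_inj (nz _ _ m) (nz _ _ m')) e.
  apply: (mulIf det); apply/eqP; rewrite -subr_eq0; apply/eqP.
  have -> : s * t' * (a * b' - a' * b) - s' * t * (a * b' - a' * b) =
    (s * a + t * a') * (s' * b + t' * b') - (s' * a + t' * a') * (s * b + t * b') by ring.
  by rewrite e subrr.
- move=> f [cf f0 f1 fX]; exists f; split => //.
  + by rewrite f0 /Phi !mul1r !mul0r !addr0.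
  + by rewrite f1 /Phi !mul1r !mul0r !add0r.
  + move=> r /fX[[s [t [m ->]]] nS]; split => //; apply/conic_point_on_conic; exact: nz.
Qed.

(** On the conic a nonzero linear form is a nonzero binary quadratic form in the
parameters. *)
Lemma conic_line_finite a b c : nonzero a b c -> finite_set (conic R `&` line a b c).
Proof.
move=> n; pose P : {poly C} := (a + c) *: 'X^2 + (2 * c) *: 'X + (b + c)%:P.
have P0 : P != 0.
  apply: contraTneq n => e.
  have c2 : a + c = 0.
    have := congr1 (fun q : {poly C} => q`_2) e.
    by rewrite /P !coefD !coefZ coefXn coefX coefC coef0 /= mulr1 mulr0 !addr0.
  have c1 : c = 0.
    have := congr1 (fun q : {poly C} => q`_1) e.
    rewrite /P !coefD !coefZ coefXn coefX coefC coef0 /= mulr1 mulr0 addr0 add0r => /eqP.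
    by rewrite mulf_eq0 pnatr_eq0 /= => /eqP.
  have c0 : b + c = 0.
    have := congr1 (fun q : {poly C} => q`_0) e.
    by rewrite /P !coefD !coefZ coefXn coefX coefC coef0 /= !mulr0 !add0r.
  move: c2 c0; rewrite c1 !addr0 => -> ->. by rewrite /nonzero eqxx.
have [rs Ers] := closed_field_poly_normal P.
apply: (@sub_finite_set _ _ (conic_point 1 0 |` (fun r => conic_point r 1) @` [set` rs])).
  move=> p [/conic_has_param[s [t [m ->]]] /(linePt _ _ _ (conic_point_nonzero m)) e].
  have [t0|t0] := eqVneq t 0.
    left; rewrite t0 in m *; apply: conic_point_eq => //; first by rewrite oner_eq0.
    by rewrite mulr0 mul1r.
  right; exists (s / t); last first.
    by apply: conic_point_eq; rewrite ?oner_eq0 ?t0 ?orbT // mulr1 divfK.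
  rewrite /= -root_prod_XsubC -(rootZ _ _ (_ : lead_coef P != 0)) ?lead_coef_eq0 // -Ers /root /P
    !(hornerD, hornerZ, hornerXn, hornerX, hornerC).
  rewrite -(mulIr_eq0 _ (mulIf (_ : t ^+ 2 != 0))) ?sqrf_eq0 //; apply/eqP.
  rewrite -e; by field.
rewrite finite_setU; split; first exact: finite_set1.
exact: finite_image.
Qed.
End Conic.

(** * Square roots on a square *)

Section Square.
Variable R : realType.
Local Notation C := R[i].

Definition unit_square (p : R * R) : Prop := 0 <= p.1 <= 1 /\ 0 <= p.2 <= 1.

Lemma scale_continuous (T : topologicalType) (f g h : T -> R) t :
  {for t, continuous f} -> {for t, continuous g} -> {for t, continuous h} ->
  {for t, continuous (fun t => (f t * g t, f t * h t))}.
Proof.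
move=> cf cg ch.
exact: (cvg_pair (@continuousM R T f g t cf cg) (@continuousM R T f h t cf ch)).
Qed.

(** This is uniform continuity in multiplicative form: along the segment from the
corner to [p], cut into [N + 1] equal steps, consecutive values of [psi] have a
quotient in the right half-plane. Compactness is applied to triples made of a position
on the segment and its end [p], near step length zero. *)
Lemma uniform_ratio (psi : R * R -> C) :
  (forall p, unit_square p -> {for p, continuous psi}) ->
  (forall p, unit_square p -> psi p != 0) ->
  exists N : nat, forall (k : nat) p, (k <= N)%N -> unit_square p ->
    0 < complex.Re (psi (k.+1%:R / N.+1%:R * p.1, k.+1%:R / N.+1%:R * p.2) /
             psi (k%:R / N.+1%:R * p.1, k%:R / N.+1%:R * p.2)).
Proof.
move=> cpsi psi0.
pose K : set (R * (R * R)) := `[0, 1]%classic `*` (`[0, 1]%classic `*` `[0, 1]%classic).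
have Ksq x : K x -> unit_square (x.1 * x.2.1, x.1 * x.2.2).
  case: x => a [u v] [/= ]; rewrite !in_itv /= => a01 [u01 v01]. split => /=.
    by apply/andP; split; [apply: mulr_ge0|apply: mulr_ile1]; lra.
  by apply/andP; split; [apply: mulr_ge0|apply: mulr_ile1]; lra.
have cK : compact K.
  by apply: compact_setX; [|apply: compact_setX]; exact: segment_compact.
have := (proj1 (compact_near_coveringP K) cK R (nbhs (0 : R))
  (fun d x => 0 < complex.Re (psi ((x.1 + d) * x.2.1, (x.1 + d) * x.2.2) /
             psi (x.1 * x.2.1, x.1 * x.2.2))) _).
move=> H; have {}H := H (nbhs_filter (0 : R)).
have [|e /= e0 He] := proj1 (nbhs_ballP (0 : R^o) _) (H _).
  move=> x Kx. have sx := Ksq x Kx.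
  (* Here z.1.1 is the position on the segment, z.1.2 its end and z.2 the step length. *)
  pose F1 (z : (R * (R * R)) * R) : C :=
    psi ((z.1.1 + z.2) * z.1.2.1, (z.1.1 + z.2) * z.1.2.2).
  pose F2 (z : (R * (R * R)) * R) : C := psi (z.1.1 * z.1.2.1, z.1.1 * z.1.2.2).
  have c1 : {for (x, 0 : R), continuous (fun z : (R * (R * R)) * R => z.1.1 : R)}.
    exact: (continuous_comp (@cvg_fst _ _ _ _ _) (@cvg_fst _ _ _ _ _)).
  have c2 : {for (x, 0 : R), continuous (fun z : (R * (R * R)) * R => z.1.2.1 : R)}.
    exact: (continuous_comp (continuous_comp (@cvg_fst _ _ _ _ _) (@cvg_snd _ _ _ _ _)) (@cvg_fst
      _ _ _ _ _)).
  have c3 : {for (x, 0 : R), continuous (fun z : (R * (R * R)) * R => z.1.2.2 : R)}.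
    exact: (continuous_comp (continuous_comp (@cvg_fst _ _ _ _ _) (@cvg_snd _ _ _ _ _)) (@cvg_snd
      _ _ _ _ _)).
  have c4 : {for (x, 0 : R), continuous (fun z : (R * (R * R)) * R => z.2 : R)} by exact: cvg_snd.
  have c5 : {for (x, 0 : R), continuous (fun z : (R * (R * R)) * R => z.1.1 + z.2 : R)}.
    exact: (@continuousD R R^o _ _ _ _ c1 c4).
  have x0 : (x.1 + 0) = x.1 by rewrite addr0.
  have cF : {for (x, 0 : R), continuous (fun z => F1 z / F2 z)}.
    apply: complex_continuousM.
      by apply: (continuous_comp (scale_continuous c5 c2 c3)); rewrite /= x0; exact: cpsi.
    apply: complex_continuousV; last exact: psi0.
    by apply: (continuous_comp (scale_continuous c1 c2 c3)); exact: cpsi.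
  have F1E : F1 (x, 0) / F2 (x, 0) = 1 by rewrite /F1 /F2 /= x0 divff // psi0.
  have o : nbhs (complex.Re (F1 (x, 0) / F2 (x, 0))) [set r : R | 0 < r].
    by apply: open_nbhs_nbhs; split; [exact: open_gt|rewrite F1E /=].
  exact: (complex_continuous_Re cF o).
pose N := Num.bound e^-1.
have HN : N.+1%:R^-1 < e.
  have := @archi_boundP R e^-1; rewrite invr_ge0 (ltW e0) => /(_ isT); rewrite -/N => eN.
  rewrite -[ltRHS]invrK ltf_pV2 ?posrE ?invr_gt0 ?ltr0n //.
  by apply: lt_trans eN _; rewrite ltr_nat.
exists N => k p kN [p1 p2].
have N0 : 0 < N.+1%:R :> R by rewrite ltr0n.
have := He (N.+1%:R^-1) _ (k%:R / N.+1%:R, p).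
rewrite /= -[X in _ + X]mul1r -mulrDl natr1; apply.
  by rewrite -ball_normE /= sub0r normrN ger0_norm ?invr_ge0 // ltW.
split; rewrite /= ?in_itv //=.
by rewrite divr_ge0 ?ler0n //= ler_pdivrMr // mul1r ler_nat (leq_trans kN).
Qed.

(** For [w] off the negative real axis, [w + |w|] has half the argument of [w], and it
is continuous in [w]. It thus serves as a principal square root up to a positive
factor, which is all that matters for signs. *)
Lemma half_root_sqr (w : C) : 0 < complex.Re w -> 0 < (w + `|w|) ^+ 2 / w.
Proof.
move=> Rw.
have w0 : w != 0 by apply: contraTneq Rw => ->; rewrite ltxx.
have -> : (w + `|w|) ^+ 2 / w = w + w^* + 2 * `|w|.
  have -> : (w + `|w|) ^+ 2 = (w + 2 * `|w|) * w + `|w| ^+ 2 by ring.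
  rewrite normCK. by field.
apply: ltr_wpDr; first by rewrite mulr_ge0.
by case: w Rw {w0} => a b /= a0; rewrite ltcE /=; rewrite subrr eqxx /=; lra.
Qed.

(** The square is star-shaped about a corner: the root at [p] is the root at the
corner times the principal roots of the successive ratios of [psi] along the segment
to [p]. *)
Lemma square_root_up_to_positive (psi : R * R -> C) :
  (forall p, unit_square p -> {for p, continuous psi}) ->
  (forall p, unit_square p -> psi p != 0) ->
  exists r : R * R -> C, (forall p, unit_square p -> {for p, continuous r}) /\
    (forall p, unit_square p -> 0 < r p ^+ 2 / psi p).
Proof.
move=> cpsi psi0.
have [N HN] := uniform_ratio cpsi psi0.
pose psik k (p : R * R) := psi (k%:R / N.+1%:R * p.1, k%:R / N.+1%:R * p.2).
pose w k (p : R * R) := psik k.+1 p / psik k p.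
pose r := fix r n (p : R * R) : C :=
  if n is k.+1 then r k p * (w k p + `|w k p|) else sqrtC (psi (0, 0)).
have N0 : 0 < N.+1%:R :> R by rewrite ltr0n.
have sq k p : (k <= N.+1)%N -> unit_square p ->
  unit_square (k%:R / N.+1%:R * p.1, k%:R / N.+1%:R * p.2).
  move=> kN [p1 p2].
  have : 0 <= (k%:R / N.+1%:R : R) <= 1.
    by apply/andP; split; [apply: divr_ge0; rewrite ler0n|rewrite ler_pdivrMr // mul1r ler_nat].
  move: (_ / _) => c /andP[c0 c1]; split => /=.
    by apply/andP; split; [apply: mulr_ge0|apply: mulr_ile1]; lra.
  by apply/andP; split; [apply: mulr_ge0|apply: mulr_ile1]; lra.
have psik0 k p : (k <= N.+1)%N -> unit_square p -> psik k p != 0.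
  by move=> kN sp; apply: psi0; exact: sq.
have cpsik k p : (k <= N.+1)%N -> unit_square p -> {for p, continuous (psik k)}.
  move=> kN sp.
  have c0 : {for p, continuous (fun _ : R * R => k%:R / N.+1%:R : R)} by exact: cst_continuous.
  have c1 : {for p, continuous (fun p : R * R => p.1 : R)} by exact: cvg_fst.
  have c2 : {for p, continuous (fun p : R * R => p.2 : R)} by exact: cvg_snd.
  exact: (continuous_comp (scale_continuous c0 c1 c2) (cpsi _ (sq k p kN sp))).
have cw k p : (k <= N)%N -> unit_square p -> {for p, continuous (w k)}.
  move=> kN sp; refine (complex_continuousM (f := psik k.+1) (g := fun p => (psik k p)^-1) _ _);
    first exact: cpsik.
  refine (complex_continuousV (f := psik k) _ _); [apply: cpsik => //|apply: psik0 => //];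
    exact: leqW.
have cr n p : (n <= N.+1)%N -> unit_square p -> {for p, continuous (r n)}.
  move=> + sp; elim: n => [_|n IH nN]; first exact: complex_continuous_cst.
  refine (complex_continuousM (f := r n) (g := fun p => w n p + `|w n p|) (IH (ltnW nN)) _).
  refine (complex_continuousD (f := w n) (g := fun p => `|w n p|)
    (cw n p nN sp) (complex_continuous_norm (cw n p nN sp))).
have pr n p : (n <= N.+1)%N -> unit_square p -> 0 < r n p ^+ 2 / psik n p.
  move=> + sp; elim: n => [_|n IH nN].
    rewrite /= sqrtCK /psik !mul0r divff ?ltr01 //; apply: psi0; split => /=; lra.
  have := mulr_gt0 (IH (ltnW nN)) (half_root_sqr (HN n p nN sp)).
  congr (0 < _); rewrite /= -/(psik n.+1 p) -/(psik n p) -/(w n p) exprMn.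
  rewrite {3}/w invf_div.
  have := psik0 n p (ltnW nN) sp; have := psik0 n.+1 p nN sp => h1 h2. field. by rewrite h1 h2.
exists (r N.+1); split=> p sp; first exact: cr.
have := pr N.+1 p (leqnn _) sp.
by rewrite /psik divff ?gt_eqF // !mul1r; case: p {sp}.
Qed.

(** The quotient of two roots of the same function is real and never zero, so the
intermediate value theorem forbids a change of sign. *)
Lemma same_sign_at_ends (r G : R -> C) :
  (forall t, 0 <= t <= 1 -> {for t, continuous r}) ->
  (forall t, 0 <= t <= 1 -> {for t, continuous G}) ->
  (forall t, 0 <= t <= 1 -> 0 < (r t / G t) ^+ 2) ->
  0 < (r 0 / G 0) * (r 1 / G 1).
Proof.
move=> cr cG pos.
have real t : 0 <= t <= 1 -> (r t / G t) = ((complex.Re (r t / G t))%:C)%C /\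
  complex.Re (r t / G t) != 0.
  move=> /pos; case: (r t / G t) => a b; rewrite expr2 ltcE /= => /andP[/eqP h1 h2].
  have : a * b = 0 by lra.
  move=> /eqP; rewrite mulf_eq0 => /orP[/eqP a0|/eqP b0]; first by exfalso; rewrite a0 in h2; nra.
  rewrite b0 in h2 *; split => //; apply/eqP => a0; rewrite a0 in h2; lra.
pose f t := complex.Re (r t / G t).
have [e0 n0] := real 0 ltac:(lra). have [e1 n1] := real 1 ltac:(lra).
rewrite e0 e1 -rmorphM ltcR ltNge; apply/negP => neg.
have cf : {within `[0, 1], continuous f}.
  apply: continuous_in_subspaceT => t; rewrite inE /= in_itv /= => t01.
  have [_ nz] := real t t01.
  have G0 : G t != 0 by apply: contraNneq nz => ->; rewrite invr0 mulr0.
  exact: (complex_continuous_Re (complex_continuousM (cr t t01) (complex_continuousV (cG t t01)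
    G0))).
have [|c c01 fc] := IVT (v := 0) ler01 cf.
  rewrite ge_min le_max /f; move: neg; move: (complex.Re _) (complex.Re _) => a b ab {e0 e1}.
  by apply/andP; split; case: lerP => //= a0; case: lerP => //= b0; exfalso; nra.
by have [_] := real c c01; rewrite -/(f c) fc eqxx.
Qed.

(** The path [psi (1, .)] followed by [psi (., 1)] backwards bounds the image of the
square, the two other sides being constant. So a root continued along the first path
and then back along the second returns to itself; [G1] and [G2] are roots on the two
paths, up to positive factors. *)
Lemma square_monodromy (psi : R * R -> C) (k : C) (G1 G2 : R -> C) :
  (forall p, unit_square p -> {for p, continuous psi}) ->
  (forall p, unit_square p -> psi p != 0) ->
  (forall t, 0 <= t <= 1 -> psi (0, t) = k /\ psi (t, 0) = k) ->
  (forall t, 0 <= t <= 1 -> {for t, continuous G1}) ->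
  (forall t, 0 <= t <= 1 -> {for t, continuous G2}) ->
  (forall t, 0 <= t <= 1 -> 0 < G1 t ^+ 2 / psi (1, t)) ->
  (forall t, 0 <= t <= 1 -> 0 < G2 t ^+ 2 / psi (t, 1)) ->
  0 < (G1 0 * G1 1) / (G2 0 * G2 1).
Proof.
move=> cpsi psi0 psik cG1 cG2 pG1 pG2.
have [r [cr pr]] := square_root_up_to_positive cpsi psi0.
have sq (a b : R) : 0 <= a <= 1 -> 0 <= b <= 1 -> unit_square (a, b) by [].
have i0 : 0 <= (0 : R) <= 1 by lra. have i1 : 0 <= (1 : R) <= 1 by lra.
have cl (a t : R) : {for t, continuous (fun t : R => (a, t) : R * R)}.
  exact: (cvg_pair (@cst_continuous _ _ a t) (@cvg_id _ (nbhs t))).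
have cc (a t : R) : {for t, continuous (fun t : R => (t, a) : R * R)}.
  exact: (cvg_pair (@cvg_id _ (nbhs t)) (@cst_continuous _ _ a t)).
have ratio (x y z : C) : 0 < x ^+ 2 / z -> 0 < y ^+ 2 / z -> 0 < (x / y) ^+ 2.
  move=> h1 h2; have := divr_gt0 h1 h2; congr (0 < _).
  have y0 : y != 0 by apply: contraTneq h2 => ->; rewrite expr0n mul0r ltxx.
  have z0 : z != 0 by apply: contraTneq h2 => ->; rewrite invr0 mulr0 ltxx.
  field. by rewrite y0 z0.
have A1 := @same_sign_at_ends (fun t => r (1, t)) G1
  (fun t h => continuous_comp (cl 1 t) (cr _ (sq 1 t i1 h))) cG1
  (fun t h => ratio _ _ _ (pr _ (sq 1 t i1 h)) (pG1 t h)).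
have A2 := @same_sign_at_ends (fun t => r (t, 1)) G2
  (fun t h => continuous_comp (cc 1 t) (cr _ (sq t 1 h i1))) cG2
  (fun t h => ratio _ _ _ (pr _ (sq t 1 h i1)) (pG2 t h)).
have z00 : r (0, 0) != 0.
  by apply: contraTneq (pr _ (sq 0 0 i0 i0)) => ->; rewrite expr0n mul0r ltxx.
have k00 := pr _ (sq 0 0 i0 i0); rewrite (proj1 (psik 0 i0)) in k00.
have B1 : 0 < r (0, 0) / r (0, 0) * (r (0, 1) / r (0, 0)).
  apply: (@same_sign_at_ends (fun t => r (0, t)) (fun=> r (0, 0))
    (fun t h => continuous_comp (cl 0 t) (cr _ (sq 0 t i0 h))) (fun t _ =>
      @complex_continuous_cst R R (r (0, 0)) t)).
  move=> t h; apply: (ratio _ _ k) => //.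
  by have := pr _ (sq 0 t i0 h); rewrite (proj1 (psik _ h)).
have B2 : 0 < r (0, 0) / r (0, 0) * (r (1, 0) / r (0, 0)).
  apply: (@same_sign_at_ends (fun t => r (t, 0)) (fun=> r (0, 0))
    (fun t h => continuous_comp (cc 0 t) (cr _ (sq t 0 h i0))) (fun t _ =>
      @complex_continuous_cst R R (r (0, 0)) t)).
  move=> t h; apply: (ratio _ _ k) => //.
  by have := pr _ (sq t 0 h i0); rewrite (proj2 (psik _ h)).
move: A1 A2 B1 B2; rewrite divff // !mul1r /= => A1 A2 B1 B2.
have nzM (x y : C) : 0 < x * y -> x != 0 /\ y != 0.
  by move=> h; split; apply: contraTneq h => ->; rewrite ?mul0r ?mulr0 ltxx.
have nzV (x y : C) : x / y != 0 -> x != 0 /\ y != 0.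
  by move=> h; split; apply: contraNneq h => ->; rewrite ?invr0 ?mul0r ?mulr0.
have [/nzV[n1 n2] /nzV[n3 n4]] := nzM _ _ A1.
have [/nzV[n5 n6] /nzV[_ n7]] := nzM _ _ A2.
have := mulr_gt0 (divr_gt0 A2 A1) (divr_gt0 B2 B1); congr (0 < _).
field. by rewrite ?n1 ?n2 ?n3 ?n4 ?n5 ?n6 ?n7 ?z00.
Qed.
End Square.

(** * A disc in the complement of the second arrangement *)

Section Disc.
Variable R : realType.
Local Notation C := R[i].

(** The parameters [s/t] of the two points where the conic meets [L1]: the roots of
[3 r^2 + 8 r + 2]. *)
Definition param1 : R := (- 4 + Num.sqrt 10) / 3.
Definition param2 : R := (- 4 - Num.sqrt 10) / 3.

Lemma sqrt10 : (Num.sqrt 10 : R) ^+ 2 = 10 /\ 3 < (Num.sqrt 10 : R) < 4.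
Proof.
have s2 : Num.sqrt 10 ^+ 2 = 10 :> R by rewrite sqr_sqrtr.
have s0 : 0 <= Num.sqrt 10 :> R by exact: sqrtr_ge0.
by split => //; apply/andP; split; nra.
Qed.

Lemma params_sum : param1 + param2 = - (8 / 3). Proof. rewrite /param1 /param2; lra. Qed.

Lemma params_prod : param1 * param2 = 2 / 3.
Proof. have [] := sqrt10; rewrite /param1 /param2; move: (Num.sqrt _) => s s2 _; nra. Qed.

Lemma params_bound : - (1 / 3) < param1 < 0 /\ - (8 / 3) < param2 < - 2.
Proof.
have [] := sqrt10; rewrite /param1 /param2; move: (Num.sqrt _) => s s2 /andP[s3 s4].
by split; apply/andP; split; nra.
Qed.

Definition arc_re (v : R) : R := (1 - v) * param1 + v * param2.

(** An arc in the parameter line of the conic from [param1] to [param2]. The lines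
[L4], [L25], [L26], [L27] meet the conic at the parameters -1/3, -2/3, -1, -2, all
between [param2] and [param1], and each of them uses one of the first two and one of
the last two. The arc goes above the first two, crosses the real axis at -5/6 and goes
below the last two, so that the argument of each of the four forms has no net
variation along it. *)
Definition arc_im (v : R) : R :=
  - (3 * arc_re v ^+ 2 + 8 * arc_re v + 2) * (arc_re v + 5 / 6) / 4.
Definition arc (v : R) : C := (arc_re v)%:C%C + 'i%C * (arc_im v)%:C%C.

Lemma arc_imE v : arc_im v = - (3 / 4) * ((arc_re v - param1) * (arc_re v - param2)) *
  (arc_re v + 5 / 6).
Proof.
have := params_sum; have := params_prod; rewrite /arc_im;
  move: param1 param2 (arc_re v) => r1 r2 x p s.
have -> : (x - r1) * (x - r2) = x ^+ 2 - (r1 + r2) * x + r1 * r2 by ring.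
by rewrite p s; field.
Qed.

Lemma arc_start : arc 0 = param1%:C%C.
Proof.
rewrite /arc arc_imE /arc_re subr0 mul1r mul0r addr0 subrr mul0r mulr0 mul0r.
by rewrite rmorph0 mulr0 addr0.
Qed.

Lemma arc_end : arc 1 = param2%:C%C.
Proof.
rewrite /arc arc_imE /arc_re !subrr mul1r mul0r add0r subrr !mulr0 mul0r.
by rewrite rmorph0 mulr0 addr0.
Qed.

Lemma arc_re_bound v : 0 <= v <= 1 -> param2 <= arc_re v <= param1.
Proof.
move=> v01; have [] := params_bound; rewrite /arc_re; move: param1 param2 => r1 r2 b1 b2.
apply/andP; split; nra.
Qed.

(** The equation says that [(r - a) (r - b)], at [r = arc v], has real part zero, and
the inequality that it has positive imaginary part. When the real part vanishes,
[arc_re v] lies outside the interval from [b] to [a], on the side of [a] where the arc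
is above the axis or on the side of [b] where it is below. *)
Lemma arc_avoids a b v : - (2 / 3) <= a <= - (1 / 3) -> -2 <= b <= -1 -> 0 <= v <= 1 ->
  (arc_re v - a) * (arc_re v - b) = arc_im v ^+ 2 ->
  0 < arc_im v * (2 * arc_re v - a - b).
Proof.
move=> ha hb /arc_re_bound; rewrite arc_imE; have [] := params_bound.
move: param1 param2 (arc_re v) => r1 r2 x b1 b2 xb.
set y := _ * (x + 5 / 6) => e.
have y0 : y != 0.
  apply/eqP => y0; move/eqP: e; rewrite y0 expr0n mulf_eq0 !subr_eq0 => /orP[] /eqP ex; subst x.
    have h1 : (a - r1) * (a - r2) < 0 by nra.
    have : 0 < - ((a - r1) * (a - r2)) * (a + 5 / 6) by nra.
    rewrite /y in y0; lra.
  have h1 : (b - r1) * (b - r2) < 0 by nra.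
  have : 0 < - ((b - r1) * (b - r2)) * - (b + 5 / 6) by nra.
  rewrite /y in y0; lra.
have y2 : 0 < y ^+ 2 by rewrite exprn_even_gt0.
have h1 : 0 <= - ((x - r1) * (x - r2)) by nra.
have [xa|xa] := ltP a x.
  have : 0 <= y by rewrite /y; nra.
  rewrite le_eqVlt eq_sym (negbTE y0) /= => yp.
  by apply: mulr_gt0 => //; lra.
have xb' : x < b by rewrite ltNge; apply/negP => bx; rewrite -e in y2; nra.
have : 0 <= - y by rewrite /y; nra.
rewrite le_eqVlt eq_sym oppr_eq0 (negbTE y0) /= => yp.
rewrite -mulrNN; apply: mulr_gt0 => //; lra.
Qed.

(** The analogue for [r^2], which is the form [x] of the tangent line [L2]; it holds
because the arc is so flat that it stays within an angle of 45 degrees of the negative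
real axis, except where it is below the axis. *)
Lemma arc_avoids0 v : 0 <= v <= 1 ->
  arc_re v ^+ 2 = arc_im v ^+ 2 -> 0 < 2 * arc_re v * arc_im v.
Proof.
move=> v01 e; have := arc_re_bound v01; have [] := params_bound; have := arc_imE v => imE b1 b2 xb.
have x0 : arc_re v < 0 by lra.
have [y0|y0] := ltP (arc_im v) 0; first by nra.
exfalso.
have xy : arc_im v = - arc_re v.
  apply/eqP; rewrite -subr_eq0 opprK; apply/eqP.
  have : (arc_im v + arc_re v) * (arc_im v - arc_re v) = 0 by nra.
  move/eqP; rewrite mulf_eq0 => /orP[/eqP //|/eqP]; lra.
have h1 : 0 <= - ((arc_re v - param1) * (arc_re v - param2)) by nra.
have x56 : - (5 / 6) <= arc_re v.
  rewrite leNgt; apply/negP => lt.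
  have : arc_im v <= 0 by rewrite imE; nra.
  lra.
move: xy; rewrite /arc_im; move: (arc_re v) x56 x0 {xb h1 e y0 imE b1 b2} => x x56 x0 e.
(* After dropping this cubic term, e bounds a quadratic polynomial without real roots. *)
have h : 0 <= x ^+ 2 * (x + 5 / 6) by apply: mulr_ge0; [exact: sqr_ge0|lra].
have := sqr_ge0 (x + 7 / 24); nra.
Qed.

(** The disc is swept by the segments [(1 - u) N1 - i u c(v)], where [c(v)] is the
point of the conic with parameter [arc v]. Along the arc the value of the form of a
branch line, relative to its value at [N1], may reach the negative real axis, but
never zero or the negative imaginary axis; the factor [-i] is there so that only the
latter has to be avoided. *)
Definition discX (p : R * R) : C :=
  (1 - p.1)%:C%C * param1%:C%C ^+ 2 - 'i%C * p.1%:C%C * arc p.2 ^+ 2.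
Definition discY (p : R * R) : C := (1 - p.1)%:C%C - 'i%C * p.1%:C%C.
Definition discZ (p : R * R) : C :=
  (1 - p.1)%:C%C * (param1%:C%C + 1) ^+ 2 - 'i%C * p.1%:C%C * (arc p.2 + 1) ^+ 2.
Definition disc (p : R * R) : CP2 R := pt (discX p) (discY p) (discZ p).

(** The expression vanishes only if [Q] is zero or a negative imaginary number. *)
Lemma disc_combination_neq0 (u A Q1 Q2 : R) (Q : C) : 0 <= u <= 1 -> 0 < A -> Q = (Q1 +i* Q2)%C ->
  (Q1 = 0 -> 0 < Q2) -> (1 - u)%:C%C * A%:C%C - 'i%C * u%:C%C * Q != 0.
Proof.
move=> u01 A0 -> h; rewrite eq_complex /=.
apply/negP => /andP[/eqP e1 /eqP e2].
have {}e1 : (1 - u) * A + u * Q2 = 0 by lra.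
have : u * Q1 = 0 by lra.
move=> /eqP; rewrite mulf_eq0 => /orP[/eqP u0|/eqP/h Q20]; first by rewrite u0 in e1; lra.
by nra.
Qed.

Lemma discX_neq0 p : unit_square p -> discX p != 0.
Proof.
move=> [u01 v01]; rewrite /discX -rmorphXn.
apply: (@disc_combination_neq0 _ _ (arc_re p.2 ^+ 2 - arc_im p.2 ^+ 2)
  (2 * arc_re p.2 * arc_im p.2)) => //.
- by have [] := params_bound => b _; nra.
- apply/eqP; rewrite /arc eq_complex expr2 /=; apply/andP; split; apply/eqP; ring.
- by move=> h; apply: arc_avoids0 => //; lra.
Qed.

Lemma discY_neq0 p : unit_square p -> discY p != 0.
Proof.
move=> [u01 v01]; rewrite /discY -[X in X - _]mulr1 -[X in _ - X]mulr1.
apply: (@disc_combination_neq0 _ 1 1 0) => //; by move=> ?; lra.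
Qed.

(** The hypothesis on [A], [B], [D] says that, on the point of the conic with
parameter [z], the linear form with these coefficients equals [k (z - a) (z - b)]. *)
Lemma disc_form_neq0 (A B D k : C) (a b : R) p : unit_square p -> k != 0 ->
  - (2 / 3) <= a <= - (1 / 3) -> -2 <= b <= -1 ->
  (forall z, A * z ^+ 2 + B + D * (z + 1) ^+ 2 = k * ((z - a%:C%C) * (z - b%:C%C))) ->
  A * discX p + B * discY p + D * discZ p != 0.
Proof.
move=> [u01 v01] k0 ha hb H.
have -> : A * discX p + B * discY p + D * discZ p =
   (1 - p.1)%:C%C * (A * param1%:C%C ^+ 2 + B + D * (param1%:C%C + 1) ^+ 2) - 'i%C * p.1%:C%C *
     (A * arc p.2 ^+ 2 + B + D * (arc p.2 + 1) ^+ 2).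
  by rewrite /discX /discY /discZ; ring.
rewrite !H [_ * (k * _)]mulrCA [X in _ - X]mulrCA -mulrBr mulf_neq0 // -!rmorphB -rmorphM.
apply: (@disc_combination_neq0 _ _ ((arc_re p.2 - a) * (arc_re p.2 - b) - arc_im p.2 ^+ 2)
  (arc_im p.2 * (2 * arc_re p.2 - a - b))) => //.
- by have [] := params_bound => b1 b2; nra.
- apply/eqP; rewrite /arc eq_complex /=; apply/andP; split; apply/eqP; ring.
- by move=> h; apply: arc_avoids => //; lra.
Qed.

Lemma disc_nonzero p : unit_square p -> nonzero (discX p) (discY p) (discZ p).
Proof. by move=> /discX_neq0; rewrite /nonzero => ->. Qed.

Lemma disc_continuous p : unit_square p -> {for p, continuous disc}.
Proof.
move=> sp.
have c1 : {for p, continuous (fun p : R * R => p.1 : R)} by exact: cvg_fst.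
have c2 : {for p, continuous (fun p : R * R => p.2 : R)} by exact: cvg_snd.
have C1 := complex_continuous_real c1. have C2 := complex_continuous_real c2.
have ca : {for p, continuous (fun p : R * R => arc p.2)}.
  have cre : {for p, continuous (fun p : R * R => (arc_re p.2)%:C%C)}.
    have -> : (fun p : R * R => (arc_re p.2)%:C%C) =
        (fun p : R * R => (1 - p.2%:C) * param1%:C + p.2%:C * param2%:C)%C.
      apply/funext => q; rewrite /arc_re; move: param1 param2 => r1 r2.
      by rewrite rmorphD !rmorphM rmorphB.
    complex_continuity; lazymatch goal with
      | |- context [@snd] => exact: c2
      | |- _ => exact: cst_continuous
      end.
  have -> : (fun p : R * R => arc p.2) = (fun p : R * R =>
      (arc_re p.2)%:C + 'i * (- (3 * (arc_re p.2)%:C ^+ 2 + 8 * (arc_re p.2)%:C + 2) *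
        ((arc_re p.2)%:C + 5 / 6) / 4))%C.
    apply/funext => q; rewrite /arc /arc_im; move: (arc_re q.2) => x.
    by rewrite !(rmorphM, rmorphD, rmorphN, fmorphV, rmorphXn, rmorph_nat).
  by complex_continuity; lazymatch goal with
    | |- context [arc_re] => exact: (complex_continuous_Re cre)
    | |- _ => rewrite pnatr_eq0
    end.
have cX : {for p, continuous discX}.
  have -> : discX = (fun p : R * R => (1 - p.1%:C) * param1%:C ^+ 2 - 'i * p.1%:C * arc p.2 ^+ 2)%C.
    by apply/funext => q; rewrite /discX rmorphB.
  complex_continuity; lazymatch goal with
    | |- context [arc] => exact: ca
    | |- context [@fst] => exact: c1
    | |- context [@snd] => exact: c2
    | |- _ => exact: cst_continuous
    end.
have cY : {for p, continuous discY}.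
  have -> : discY = (fun p : R * R => (1 - p.1%:C) - 'i * p.1%:C)%C.
    by apply/funext => q; rewrite /discY rmorphB.
  complex_continuity; lazymatch goal with
    | |- context [arc] => exact: ca
    | |- context [@fst] => exact: c1
    | |- context [@snd] => exact: c2
    | |- _ => exact: cst_continuous
    end.
have cZ : {for p, continuous discZ}.
  have -> : discZ = (fun p : R * R =>
    (1 - p.1%:C) * (param1%:C + 1) ^+ 2 - 'i * p.1%:C * (arc p.2 + 1) ^+ 2)%C.
    by apply/funext => q; rewrite /discZ rmorphB.
  complex_continuity; lazymatch goal with
    | |- context [arc] => exact: ca
    | |- context [@fst] => exact: c1
    | |- context [@snd] => exact: c2
    | |- _ => exact: cst_continuous
    end.
exact: (pt_continuous cX cY cZ (disc_nonzero sp)).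
Qed.
End Disc.

(** * The two arrangements and their components *)

Section Arrangement.
Variable R : realType.
Local Notation C := R[i].

Lemma robustly_arc_connected_infinite (T : topologicalType) (X : set T) a b :
  robustly_arc_connected R X -> X a -> X b -> a <> b -> infinite_set X.
Proof.
move=> aX Xa Xb ab fX; have [p [_ _ _ /(_ (1 / 2))]] := aX a b Xa Xb ab X fX.
by case=> //; lra.
Qed.

Lemma line_points (a b c : C) : nonzero a b c ->
  exists p q, [/\ line a b c p, line a b c q & p <> q].
Proof.
move=> n; have [a0|a0] := eqVneq a 0.
  have n1 : nonzero (1 : C) 0 0 by rewrite /nonzero oner_eq0.
  have n2 : nonzero 0 (- c) b by move: n; rewrite /nonzero a0 oppr_eq0 eqxx /= orbC.
  exists (pt 1 0 0), (pt 0 (- c) b); split.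
  - by apply/(linePt _ _ _ n1); rewrite a0 !mulr0 mul0r !addr0.
  - by apply/(linePt _ _ _ n2); rewrite a0; ring.
  - move=> /(pt_eqP n1 n2)[l l0 [/eqP]]; rewrite mulr1 eq_sym => /eqP e; by rewrite e eqxx in l0.
have n1 : nonzero (- b) a 0 by rewrite /nonzero a0 orbT.
have n2 : nonzero (- c) 0 a by rewrite /nonzero a0 !orbT.
exists (pt (- b) a 0), (pt (- c) 0 a); split.
- by apply/(linePt _ _ _ n1); ring.
- by apply/(linePt _ _ _ n2); ring.
- move=> /(pt_eqP n1 n2)[l l0 [_ _ /eqP]]; by rewrite mulr0 (negbTE a0).
Qed.

(** The entry of index 0 is [L1]; the six others form the branch locus. *)
Definition lines1 : seq (int * int * int) :=
  [:: (1, 2, -4); (1, 0, 0); (0, 1, 0); (1, -1, 2); (2, 2, -5); (1, 7, -4); (2, -2, 1)].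
Definition lines2 : seq (int * int * int) :=
  [:: (1, 2, -4); (1, 0, 0); (0, 1, 0); (1, -1, 2); (1, 3, -7); (1, 0, -4); (1, -1, 5)].

Definition int_line (t : int * int * int) : set (CP2 R) :=
  line t.1.1%:~R t.1.2%:~R t.2%:~R.

Definition cross (t u : int * int * int) : int * int * int :=
  (t.1.2 * u.2 - t.2 * u.1.2, t.2 * u.1.1 - t.1.1 * u.2, t.1.1 * u.1.2 - t.1.2 * u.1.1).

Definition distinct_lines (l : seq (int * int * int)) :=
  forall i j : 'I_7, i != j -> cross (nth (0, 0, 0) l i) (nth (0, 0, 0) l j) != (0, 0, 0).

Lemma lines1_distinct : distinct_lines lines1.
Proof. by do 2!case=> [[|[|[|[|[|[|[|//]]]]]]] ?]. Qed.

Lemma lines2_distinct : distinct_lines lines2.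
Proof. by do 2!case=> [[|[|[|[|[|[|[|//]]]]]]] ?]. Qed.

Definition component (l : seq (int * int * int)) (j : option 'I_7) : set (CP2 R) :=
  if j is Some k then int_line (nth (0, 0, 0) l k) else conic R.

Lemma cross_nonzero t u : cross t u != (0, 0, 0) ->
  nonzero (t.1.2%:~R * u.2%:~R - t.2%:~R * u.1.2%:~R)
          (t.2%:~R * u.1.1%:~R - t.1.1%:~R * u.2%:~R)
          (t.1.1%:~R * u.1.2%:~R - t.1.2%:~R * u.1.1%:~R : C).
Proof.
rewrite /nonzero -!intrM -!intrB !intr_eq0; apply: contraR.
by rewrite !negb_or !negbK /cross => /and3P[/eqP -> /eqP -> /eqP ->].
Qed.

Section DistinctLines.
Variable l : seq (int * int * int).
Hypothesis gl : distinct_lines l.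

Lemma distinct_lines_nonzero (i : 'I_7) : nonzero (nth (0, 0, 0) l i).1.1%:~R
   (nth (0, 0, 0) l i).1.2%:~R ((nth (0, 0, 0) l i).2%:~R : C).
Proof.
rewrite /nonzero !intr_eq0.
have [j ij] : exists j, i != j.
  by exists (if i == ord0 then ord_max else ord0); case: (eqVneq i ord0) => [->|].
apply: contraR (gl ij); rewrite !negb_or !negbK => /and3P[/eqP e1 /eqP e2 /eqP e3].
by rewrite /cross e1 e2 e3 !mul0r subrr.
Qed.

Lemma component_closed j : closed (component l j).
Proof. case: j => [k|]; [exact: line_closed|exact: conic_closed]. Qed.

Lemma component_robustly_arc_connected j : robustly_arc_connected R (component l j).
Proof. case: j => [k|]; [exact: line_robustly_arc_connected|exact: conic_robustly_arc_connected].
Qed.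

Lemma lines_meet (i j : 'I_7) p q : i != j -> component l (Some i) p -> component l (Some j) p ->
  component l (Some i) q -> component l (Some j) q -> p = q.
Proof.
move=> ij ip jp iq jq; have n := cross_nonzero (gl ij).
by rewrite (line_line n ip jp) (line_line n iq jq).
Qed.

Lemma component_finite i j : i != j -> finite_set (component l i `&` component l j).
Proof.
case: i j => [i|] [j|] //= ij.
- apply: (@sub_finite_set _ _ _ _ (finite_set1 _)) => p [ip jp] /=.
  exact: (line_line (cross_nonzero (gl (ij : i != j))) ip jp).
- rewrite setIC; exact: conic_line_finite (distinct_lines_nonzero i).
- exact: conic_line_finite (distinct_lines_nonzero j).
Qed.

Lemma component_points j : exists p q, [/\ component l j p, component l j q & p <> q].
Proof.
case: j => [i|]; first exact: line_points (distinct_lines_nonzero i).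
have n1 : ((1 : C) != 0) || ((0 : C) != 0) by rewrite oner_eq0.
have n2 : ((0 : C) != 0) || ((1 : C) != 0) by rewrite oner_eq0 orbT.
exists (conic_point 1 0), (conic_point 0 1); split;
  [exact: conic_point_on_conic|exact: conic_point_on_conic|].
move=> /(conic_point_inj n1 n2) /eqP; by rewrite mulr1 mul0r oner_eq0.
Qed.
End DistinctLines.

(** A component is infinite, while two distinct ones share finitely many points. *)
Lemma component_inj l i j : distinct_lines l -> component l i `<=` component l j -> i = j.
Proof.
move=> gl ij; apply/eqP; apply: contraT => /(component_finite gl).
have [p [q [ip iq pq]]] := component_points gl i.
rewrite setIidl // => fi; by case: (robustly_arc_connected_infinite
  (@component_robustly_arc_connected l i) ip iq pq).
Qed.

Lemma int_lineE t (F : C -> C -> C -> C) :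
  (forall x y z, F x y z = t.1.1%:~R * x + t.1.2%:~R * y + t.2%:~R * z) ->
  curve F = int_line t.
Proof. by move=> e; congr curve; apply/funext => x; apply/funext => y; apply/funext => z; exact: e.
Qed.

Lemma component_union t1 t2 t3 t4 t5 t6 t7 :
  (conic R `|` int_line t1) `|` (int_line t2 `|` int_line t3 `|` int_line t4 `|`
     int_line t5 `|` int_line t6 `|` int_line t7) =
  [set p | exists j, component [:: t1; t2; t3; t4; t5; t6; t7] j p].
Proof.
apply/seteqP; split => p; last first.
  by move=> [[[[|[|[|[|[|[|[|//]]]]]]] ?]|] /= h]; rewrite /setU /=; tauto.
move=> [[h|h]|[[[[[h|h]|h]|h]|h]|h]]; first by exists None.
- by exists (Some (inord 0)); rewrite /= inordK.
- by exists (Some (inord 1)); rewrite /= inordK.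
- by exists (Some (inord 2)); rewrite /= inordK.
- by exists (Some (inord 3)); rewrite /= inordK.
- by exists (Some (inord 4)); rewrite /= inordK.
- by exists (Some (inord 5)); rewrite /= inordK.
- by exists (Some (inord 6)); rewrite /= inordK.
Qed.

Lemma arrangement1_components : conic_line R `|` B1 R = [set p | exists j, component lines1 j p].
Proof.
rewrite -component_union.
congr ((_ `|` _) `|` (_ `|` _ `|` _ `|` _ `|` _ `|` _));
  by apply: int_lineE => x y z /=; ring.
Qed.

Lemma arrangement2_components : conic_line R `|` B2 R = [set p | exists j, component lines2 j p].
Proof.
rewrite -component_union.
congr ((_ `|` _) `|` (_ `|` _ `|` _ `|` _ `|` _ `|` _));
  by apply: int_lineE => x y z /=; ring.
Qed.

(** The map and its inverse both send a component into a component; composing them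
shows that these inclusions are equalities. *)
Lemma component_image l m (g h : CP2 R -> CP2 R) : distinct_lines l -> distinct_lines m ->
  continuous g -> continuous h -> cancel h g -> cancel g h ->
  (forall p, (exists j, component l j p) <-> (exists j, component m j (g p))) ->
  forall j, exists k, forall p, component l j p <-> component m k (g p).
Proof.
move=> gl gm cg ch hg gh U j.
have image l' m' (f : CP2 R -> CP2 R) i : distinct_lines l' -> distinct_lines m' ->
  continuous f -> injective f ->
    (forall p, (exists j, component l' j p) -> (exists j, component m' j (f p))) ->
    exists k, forall p, component l' i p -> component m' k (f p).
  move=> gl' gm' cf fi U'; have [p [q [ip iq pq]]] := component_points gl' i.
  apply: (@image_in_one_component R _ _ _ _ (component m') f p q) => //.
  - exact: component_robustly_arc_connected.
  - exact: component_closed.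
  - exact: component_finite.
  - by move=> x ix; apply: U'; exists i.
have [k jk] := image l m g j gl gm cg (can_inj gh) (fun p => proj1 (U p)).
have [|i ki] := image m l h k gm gl ch (can_inj hg).
  by move=> p pm; apply/U; rewrite hg.
have ji : j = i by apply: (component_inj gl) => p /jk /ki; rewrite gh.
exists k => p; split; first exact: jk.
by move=> /ki; rewrite gh ji.
Qed.

End Arrangement.

(** * The boundary of the disc and the nodes *)

Section Nodes.
Variable R : realType.
Local Notation C := R[i].
Implicit Types x y z : C.

Definition node1 : CP2 R := conic_point (param1 R)%:C%C 1.
Definition node2 : CP2 R := conic_point (param2 R)%:C%C 1.

Lemma param_nonzero (s : C) : (s != 0) || ((1 : C) != 0).
Proof. by rewrite oner_eq0 orbT. Qed.

Lemma on_int_line t x y z : nonzero x y z ->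
  int_line t (pt x y z) <-> t.1.1%:~R * x + t.1.2%:~R * y + t.2%:~R * z = 0.
Proof. exact: linePt. Qed.

Lemma disc_avoids (p : R * R) (k : 'I_7) : unit_square p -> k != ord0 ->
  ~ component lines2 (Some k) (disc p).
Proof.
move=> sp k0 /(on_int_line _ (disc_nonzero sp)) /eqP; apply/negP.
have c2 : (2 : C) != 0 by rewrite pnatr_eq0.
have c3 : (3 : C) != 0 by rewrite pnatr_eq0.
(* In the last four cases, a and b are the parameters where the line meets the conic. *)
case: k k0 => [[|[|[|[|[|[|[|//]]]]]]] hk] // _ /=.
- rewrite !mul0r !addr0 mul1r; exact: discX_neq0.
- rewrite !mul0r !addr0 add0r mul1r; exact: discY_neq0.
- apply: (@disc_form_neq0 _ _ _ _ 3 (- (1 / 3)) (- 1)) => //; try lra.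
  by move=> z; rewrite !(rmorphN, rmorphM, fmorphV, rmorph_nat, rmorph1); field.
- apply: (@disc_form_neq0 _ _ _ _ (- 6) (- (1 / 3)) (- 2)) => //; try lra.
    by rewrite oppr_eq0 pnatr_eq0.
  by move=> z; rewrite !(rmorphN, rmorphM, fmorphV, rmorph_nat, rmorph1); field.
- apply: (@disc_form_neq0 _ _ _ _ (- 3) (- (2 / 3)) (- 2)) => //; try lra.
    by rewrite oppr_eq0 pnatr_eq0.
  by move=> z; rewrite !(rmorphN, rmorphM, fmorphV, rmorph_nat, rmorph1); field.
- apply: (@disc_form_neq0 _ _ _ _ 6 (- (2 / 3)) (- 1)) => //; try lra.
    by rewrite pnatr_eq0.
  by move=> z; rewrite !(rmorphN, rmorphM, fmorphV, rmorph_nat, rmorph1); field.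
Qed.

Lemma disc_left (t : R) : 0 <= t <= 1 -> disc (0, t) = node1 /\ disc (t, 0) = node1.
Proof.
move=> t01; have i0 : 0 <= (0 : R) <= 1 by lra.
split; apply: pt_eq_cross; rewrite ?conic_point_nonzero ?param_nonzero ?disc_nonzero //;
  by rewrite /discX /discY /discZ /= ?arc_start ?subr0 ?rmorph0 ?rmorph1; ring.
Qed.

Lemma disc_top (t : R) : 0 <= t <= 1 -> disc (1, t) = conic_point (arc t) 1.
Proof.
move=> t01; have i1 : 0 <= (1 : R) <= 1 by lra.
apply: pt_eq_cross; rewrite ?conic_point_nonzero ?param_nonzero ?disc_nonzero //;
  by rewrite /discX /discY /discZ /= subrr ?rmorph0 ?rmorph1; ring.
Qed.

Lemma disc_corner : disc (1, 1 : R) = node2.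
Proof.
rewrite disc_top ?arc_end //; lra.
Qed.

(** At the point of the conic with parameter [z], the form of [L1] takes the opposite
of the left side. *)
Lemma node_factor (z : C) : 3 * z ^+ 2 + 8 * z + 2 = 3 * ((z - (param1 R)%:C%C) *
  (z - (param2 R)%:C%C)).
Proof.
have s := congr1 (real_complex R) (params_sum R); have p := congr1 (real_complex R) (params_prod R).
have -> : (z - (param1 R)%:C%C) * (z - (param2 R)%:C%C) =
  z ^+ 2 - ((param1 R)%:C%C + (param2 R)%:C%C) * z + (param1 R)%:C%C * (param2 R)%:C%C by ring.
by rewrite -rmorphD -rmorphM /= s p !(rmorphN, rmorphM, fmorphV, rmorph_nat) /=; field.
Qed.

Lemma disc_right (t : R) : 0 <= t <= 1 -> component lines1 (Some ord0) (disc (t, 1)).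
Proof.
move=> t01; have i1 : 0 <= (1 : R) <= 1 by lra.
have sq : unit_square (t, 1 : R) by split.
apply/(on_int_line _ (disc_nonzero sq)) => /=.
rewrite /discX /discY /discZ /= arc_end.
have h1 := node_factor (param1 R)%:C%C; have h2 := node_factor (param2 R)%:C%C.
rewrite subrr mul0r mulr0 in h1; rewrite subrr !mulr0 in h2.
set u := (1 - t)%:C%C; set v := t%:C%C; set a := (param1 R)%:C%C in h1 *;
  set b := (param2 R)%:C%C in h2 *.
have -> : 1%:~R * (u * a ^+ 2 - 'i%C * v * b ^+ 2) + 2%:~R * (u - 'i%C * v) +
    (-4)%:~R * (u * (a + 1) ^+ 2 - 'i%C * v * (b + 1) ^+ 2)
  = - u * (3 * a ^+ 2 + 8 * a + 2) + 'i%C * v * (3 * b ^+ 2 + 8 * b + 2) by ring.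
by rewrite h1 h2 !mulr0 addr0.
Qed.

Lemma nodes_neq : node1 <> node2.
Proof.
move=> /(conic_point_inj (param_nonzero _) (param_nonzero _)); rewrite !mulr1 => /complexI e.
have [] := params_bound R; rewrite e; lra.
Qed.

Lemma conic_L1_nodes p : conic R p -> component lines1 (Some ord0) p -> p = node1 \/ p = node2.
Proof.
move=> /conic_has_param[s [t [n ->]]] /(on_int_line _ (conic_point_nonzero n)) /= e.
have e' : 3 * s ^+ 2 + 8 * s * t + 2 * t ^+ 2 = 0.
  rewrite -[RHS]oppr0 -e; ring.
have t0 : t != 0.
  apply: contraTneq n => t0; move/eqP: e';
    rewrite t0 expr0n /= !mulr0 !addr0 mulf_eq0 pnatr_eq0 /= sqrf_eq0 => ->.
  by rewrite eqxx.
have : 3 * ((s / t - (param1 R)%:C%C) * (s / t - (param2 R)%:C%C)) = 0.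
  rewrite -node_factor; apply: (mulIf (_ : t ^+ 2 != 0)); first by rewrite sqrf_eq0.
  by rewrite mul0r -e'; field.
move=> /eqP; rewrite !mulf_eq0 pnatr_eq0 /= => /orP[] /eqP /subr0_eq h; [left|right];
  by apply: conic_point_eq; rewrite ?param_nonzero // -h mulr1 divfK.
Qed.

End Nodes.

(** * The double cover branched along the first arrangement *)

Section DoubleCover.
Variable R : realType.
Local Notation C := R[i].
Implicit Types x y z : C.

Definition form4 x y z := x - y + 2 * z.
Definition form5 x y z := 2 * x + 2 * y - 5 * z.
Definition form6 x y z := x + 7 * y - 4 * z.
Definition form7 x y z := 2 * x - 2 * y + z.

(** The four points of the conic on the last four lines are the vertices of an
inscribed quadrilateral with sides [form4], [form5], [form6], [form7] in this cyclic
order; so both products of opposite sides cut the same points on the conic. *)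
Lemma opposite_sides x y z : conic_form x y z = 0 ->
  form5 x y z * form7 x y z = form4 x y z * form6 x y z.
Proof.
move=> e; apply/eqP; rewrite -subr_eq0; apply/eqP.
have -> : form5 x y z * form7 x y z - form4 x y z * form6 x y z = 3 * conic_form x y z.
  by rewrite /form4 /form5 /form6 /form7 /conic_form; ring.
by rewrite e mulr0.
Qed.

(** The product of the six branch forms divided by the sixth power of one of them,
[x]. *)
Definition branch x y z :=
  y * form4 x y z * form5 x y z * form6 x y z * form7 x y z / x ^+ 5.

(** A square root of [branch] on the conic: there [(z - x - y) / 2] is [s t], whose
square is [x y], and [form5 * form7 = form4 * form6]. *)
Definition conic_root x y z :=
  (z - x - y) / 2 * form4 x y z * form6 x y z / x ^+ 3.

(** A square root of [branch] on [L1], up to a constant: there [form4], [form6] and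
[form7] are multiples of [x], [y] and [form5]. *)
Definition line_root x y z := y * form5 x y z / x ^+ 2.

Lemma branch_homog0 : homog0 branch.
Proof.
move=> a x y z a0; have [->|x0] := eqVneq x 0; first by rewrite /branch mulr0 expr0n invr0 !mulr0.
by rewrite /branch /form4 /form5 /form6 /form7; field; rewrite x0 a0.
Qed.

Lemma conic_root_homog0 : homog0 conic_root.
Proof.
move=> a x y z a0; have [->|x0] := eqVneq x 0;
  first by rewrite /conic_root mulr0 expr0n invr0 !mulr0.
by rewrite /conic_root /form4 /form6; field; rewrite x0 a0.
Qed.

Lemma line_root_homog0 : homog0 line_root.
Proof.
move=> a x y z a0; have [->|x0] := eqVneq x 0;
  first by rewrite /line_root mulr0 expr0n invr0 !mulr0.
by rewrite /line_root /form5; field; rewrite x0 a0.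
Qed.

Lemma branch_continuous x y z : x != 0 -> {for pt x y z, continuous (descend branch)}.
Proof.
move=> x0; apply: (descend_continuous branch_homog0 x0) => v v0.
by rewrite /branch /form4 /form5 /form6 /form7; complex_continuity; rewrite expf_neq0.
Qed.

Lemma conic_root_continuous x y z : x != 0 -> {for pt x y z, continuous (descend conic_root)}.
Proof.
move=> x0; apply: (descend_continuous conic_root_homog0 x0) => v v0.
by rewrite /conic_root /form4 /form6; complex_continuity; rewrite ?expf_neq0 // pnatr_eq0.
Qed.

Lemma line_root_continuous x y z : x != 0 -> {for pt x y z, continuous (descend line_root)}.
Proof.
move=> x0; apply: (descend_continuous line_root_homog0 x0) => v v0.
by rewrite /line_root /form5; complex_continuity; rewrite expf_neq0.
Qed.

Definition off_branch_lines (p : CP2 R) := forall k : 'I_7, k != ord0 ->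
  ~ component lines1 (Some k) p.

Lemma off_branch_lines_pt p : off_branch_lines p -> exists x y z, [/\ nonzero x y z, p = pt x y z &
  [/\ x != 0, y != 0, form4 x y z != 0, form5 x y z != 0 & form6 x y z != 0 /\ form7 x y z != 0]].
Proof.
have [x [y [z [n ->]]]] := pt_surj p => off; exists x, y, z; split => //.
have H k (k7 : (k < 7)%N) : k != 0%N ->
    (nth (0, 0, 0) lines1 k).1.1%:~R * x + (nth (0, 0, 0) lines1 k).1.2%:~R * y +
    (nth (0, 0, 0) lines1 k).2%:~R * z != 0.
  move=> k0; apply/eqP => e; apply: (off (Ordinal k7)); first by rewrite -val_eqE.
  exact/(on_int_line _ n).
split; [|move: (H 2%N isT isT)|move: (H 3%N isT isT)|move: (H 4%N isT isT)|split;
  [move: (H 5%N isT isT)|move: (H 6%N isT isT)]]; last first.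
- by congr (_ != 0); rewrite /= /form7; ring.
- by congr (_ != 0); rewrite /= /form6; ring.
- by congr (_ != 0); rewrite /= /form5; ring.
- by congr (_ != 0); rewrite /= /form4; ring.
- by congr (_ != 0); rewrite /=; ring.
- by move: (H 1%N isT isT); congr (_ != 0); rewrite /=; ring.
Qed.

Lemma branch_neq0 p : off_branch_lines p -> descend branch p != 0.
Proof.
move=> /off_branch_lines_pt[x [y [z [n -> [x0 y0 f4 f5 [f6 f7]]]]]].
by rewrite (descend_pt branch_homog0 n) /branch !mulf_neq0 // invr_eq0 expf_neq0.
Qed.

Lemma conic_root_branch p : off_branch_lines p -> conic R p ->
  0 < descend conic_root p ^+ 2 / descend branch p.
Proof.
move=> /off_branch_lines_pt[x [y [z [n -> [x0 y0 f4 f5 [f6 f7]]]]]] /(conicPt n) e.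
rewrite (descend_pt conic_root_homog0 n) (descend_pt branch_homog0 n).
have e1 : ((z - x - y) / 2) ^+ 2 = x * y.
  apply/eqP; rewrite -subr_eq0; apply/eqP.
  have -> : ((z - x - y) / 2) ^+ 2 - x * y = conic_form x y z / 4 by rewrite /conic_form; field.
  by rewrite e mul0r.
have e2 := opposite_sides e.
rewrite /conic_root /branch; move: (form4 x y z) (form5 x y z) (form6 x y z) (form7 x y z) f4 f5
  f6 f7 e2 => a b c d a0 b0 c0 d0 e2.
have -> : ((z - x - y) / 2 * a * c / x ^+ 3) ^+ 2 =
  ((z - x - y) / 2) ^+ 2 * (a * c) * (a * c) / x ^+ 6 by field.
rewrite e1 -{1}e2.
have -> // : x * y * (b * d) * (a * c) / x ^+ 6 / (y * a * b * c * d / x ^+ 5) = 1.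
by field; rewrite x0 y0 a0 b0 c0 d0.
Qed.

Lemma line_root_branch p : off_branch_lines p -> component lines1 (Some ord0) p ->
  0 < descend line_root p ^+ 2 / descend branch p.
Proof.
move=> /off_branch_lines_pt[x [y [z [n -> [x0 y0 f4 f5 [f6 f7]]]]]] /(on_int_line _ n) /= e.
rewrite (descend_pt line_root_homog0 n) (descend_pt branch_homog0 n).
have {}e : z = (x + 2 * y) / 4.
  have c4 : (4 : C) != 0 by rewrite pnatr_eq0.
  apply: (mulIf c4); rewrite divfK //; apply/eqP; rewrite -subr_eq0; apply/eqP.
  by rewrite -oppr0 -e; ring.
have e4 : form4 x y z = 3 * x / 2 by rewrite /form4 e; field.
have e6 : form6 x y z = 5 * y by rewrite /form6 e; field.
have e7 : form7 x y z = 3 * form5 x y z by rewrite /form5 /form7 e; field.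
rewrite /line_root /branch e4 e6 e7; move: (form5 x y z) f5 => b b0.
have -> : (y * b / x ^+ 2) ^+ 2 / (y * (3 * x / 2) * b * (5 * y) * (3 * b) / x ^+ 5) = 2 / 45.
  by field; rewrite x0 y0 b0.
by rewrite divr_gt0 ?ltr0n.
Qed.

Lemma node_ratio (r : R) : r != 0 -> r + 3 != 0 -> 3 * r + 1 != 0 ->
  descend conic_root (conic_point r%:C%C 1) / descend line_root (conic_point r%:C%C 1) =
  ((r + 1) * (3 * r - 1) / r)%:C%C.
Proof.
move=> r0 r3 r1; rewrite (descend_pt conic_root_homog0 (conic_point_nonzero (param_nonzero _)))
  (descend_pt line_root_homog0 (conic_point_nonzero (param_nonzero _))).
rewrite /conic_root /line_root /form4 /form5 /form6 !(rmorphM, rmorphD, rmorphB, fmorphV,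
  rmorph_nat, rmorph1) /=.
move: r0 r3 r1; rewrite -!(fmorph_eq0 (real_complex R)) !(rmorphD, rmorphM, rmorph_nat, rmorph1) /=.
move: (r%:C)%C => {}r r0 r3 r1.
have e5 : 2 * r ^+ 2 + 2 * 1 ^+ 2 - 5 * (r + 1) ^+ 2 = - ((r + 3) * (3 * r + 1)) by ring.
rewrite e5; field.
by rewrite r0 r3 r1.
Qed.

(** By the formula of [node_ratio], the product is a symmetric function of the
parameters of the nodes, which are the roots of [3 r^2 + 8 r + 2]. *)
Lemma nodes_sign : (descend conic_root (node1 R) / descend line_root (node1 R)) *
  (descend conic_root (node2 R) / descend line_root (node2 R)) < 0.
Proof.
have [b1 b2] := params_bound R.
rewrite /node1 /node2 !node_ratio; try by apply/eqP; lra.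
rewrite -rmorphM ltcR.
have := params_sum R; have := params_prod R; move: (param1 R) (param2 R) b1 b2 => r1 r2 b1 b2 p s.
have -> : (r1 + 1) * (3 * r1 - 1) / r1 * ((r2 + 1) * (3 * r2 - 1) / r2) =
  (r1 * r2 + (r1 + r2) + 1) * (9 * (r1 * r2) - 3 * (r1 + r2) + 1) / (r1 * r2).
  field. by apply/andP; split; apply/eqP; lra.
rewrite p s; lra.
Qed.

End DoubleCover.

(** * Following the components and the disc through the map *)

Section Contradiction.
Variable R : realType.
Local Notation C := R[i].
Implicit Types x y z : C.

(** [L2] and [L3] are tangent to the conic. *)
Lemma conic_tangent (p q : CP2 R) (k : 'I_7) : (val k == 1)%N || (val k == 2)%N ->
  conic R p -> conic R q -> component lines1 (Some k) p -> component lines1 (Some k) q -> p = q.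
Proof.
move=> k12 /conic_has_param[s [t [n ->]]] /conic_has_param[s' [t' [n' ->]]].
move=> /(on_int_line _ (conic_point_nonzero n)) + /(on_int_line _ (conic_point_nonzero n')).
case/orP: k12 => /eqP /= -> /=; rewrite !mul0r !addr0 ?add0r !mul1r => /eqP + /eqP;
  rewrite !sqrf_eq0 => /eqP e /eqP e'; apply: conic_point_eq => //; by rewrite e e' ?mul0r ?mulr0.
Qed.

(** Each vertex of the inscribed quadrilateral lies on two sides; algebraically, if
one of the four forms vanishes at a point of the conic, so does one of the two in the
other product of [form5 * form7 = form4 * form6]. *)
Lemma conic_secant (p : CP2 R) (k : 'I_7) : (2 < val k)%N -> conic R p ->
  component lines1 (Some k) p ->
  exists2 j : 'I_7, j != k & component lines1 (Some j) p.
Proof.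
move=> k2; have [x [y [z [n ->]]]] := pt_surj p => /(conicPt n) e /(on_int_line _ n) ek.
have e2 := opposite_sides e.
have H j (j7 : (j < 7)%N) :
    (nth (0, 0, 0) lines1 j).1.1%:~R * x + (nth (0, 0, 0) lines1 j).1.2%:~R * y +
    (nth (0, 0, 0) lines1 j).2%:~R * z = 0 ->
    component lines1 (Some (Ordinal j7)) (pt x y z : CP2 R).
  by move=> ej; apply/(on_int_line _ n).
have E3 : 1%:~R * x + (-1)%:~R * y + 2%:~R * z = form4 x y z by rewrite /form4; ring.
have E4 : 2%:~R * x + 2%:~R * y + (-5)%:~R * z = form5 x y z by rewrite /form5; ring.
have E5 : 1%:~R * x + 7%:~R * y + (-4)%:~R * z = form6 x y z by rewrite /form6; ring.
have E6 : 2%:~R * x + (-2)%:~R * y + 1%:~R * z = form7 x y z by rewrite /form7; ring.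
have {}H3 := H 3%N isT; have {}H4 := H 4%N isT; have {}H5 := H 5%N isT; have {}H6 := H 6%N isT.
rewrite /= E3 in H3; rewrite /= E4 in H4; rewrite /= E5 in H5; rewrite /= E6 in H6.
case: k k2 ek => [[|[|[|[|[|[|[|//]]]]]]] hk] // _ /=; rewrite ?E3 ?E4 ?E5 ?E6 => ek;
  rewrite ek ?mul0r ?mulr0 in e2; move/eqP: e2; rewrite ?(eq_sym 0) mulf_eq0 => /orP[] /eqP h.
- by exists (Ordinal (isT : (4 < 7)%N)) => //; exact: H4.
- by exists (Ordinal (isT : (6 < 7)%N)) => //; exact: H6.
- by exists (Ordinal (isT : (3 < 7)%N)) => //; exact: H3.
- by exists (Ordinal (isT : (5 < 7)%N)) => //; exact: H5.
- by exists (Ordinal (isT : (4 < 7)%N)) => //; exact: H4.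
- by exists (Ordinal (isT : (6 < 7)%N)) => //; exact: H6.
- by exists (Ordinal (isT : (3 < 7)%N)) => //; exact: H3.
- by exists (Ordinal (isT : (5 < 7)%N)) => //; exact: H5.
Qed.

Lemma node_conic : conic R (node1 R) /\ conic R (node2 R).
Proof. by split; apply: conic_point_on_conic; exact: param_nonzero. Qed.

Lemma node_L1 : component lines2 (Some ord0) (node1 R) /\ component lines2 (Some ord0) (node2 R).
Proof.
have i0 : 0 <= (0 : R) <= 1 by lra. have i1 : 0 <= (1 : R) <= 1 by lra.
split; first by rewrite -(proj1 (disc_left i1)); exact: disc_right.
by rewrite -disc_corner; exact: disc_right.
Qed.

Lemma node_off (k : 'I_7) : k != ord0 ->
  ~ component lines2 (Some k) (node1 R) /\ ~ component lines2 (Some k) (node2 R).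
Proof.
have i0 : 0 <= (0 : R) <= 1 by lra. have i1 : 0 <= (1 : R) <= 1 by lra.
move=> k0; split.
  by rewrite -(proj1 (disc_left i0)); apply: disc_avoids.
by rewrite -disc_corner; apply: disc_avoids.
Qed.

Lemma L4_conic : exists p q, [/\ p <> q, conic R p, conic R q &
  component lines2 (Some (inord 3)) p /\ component lines2 (Some (inord 3)) q].
Proof.
have n (t : C) : ((1 : C) != 0) || (t != 0) by rewrite oner_eq0.
exists (conic_point 1 (- 3)), (conic_point 1 (- 1)); split; try exact: conic_point_on_conic (n _).
  move=> /(conic_point_inj (n _) (n _)) /eqP.
  rewrite !mul1r -subr_eq0 (_ : - 1 - - 3 = 2); last by ring.
  by rewrite pnatr_eq0.
by split; apply/(on_int_line _ (conic_point_nonzero (n _))); rewrite /= inordK //=; ring.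
Qed.

Variables (g : CP2 R -> CP2 R) (phi : option 'I_7 -> option 'I_7).
Hypothesis cg : continuous g.
Hypothesis ig : injective g.
Hypothesis gphi : forall j p, component lines2 j p <-> component lines1 (phi j) (g p).

Lemma phi_inj : injective phi.
Proof.
move=> i j e; apply: (@component_inj R _ _ _ lines2_distinct) => p /gphi; rewrite e; by move/gphi.
Qed.

Lemma two_points_conic i j (p q : CP2 R) : i != j -> p <> q -> component lines2 i p ->
  component lines2 i q ->
  component lines2 j p -> component lines2 j q -> phi i = None \/ phi j = None.
Proof.
move=> ij pq /gphi ip /gphi iq /gphi jp /gphi jq.
case ei: (phi i) => [k|]; last by left. case ej: (phi j) => [l|]; last by right.
rewrite ei in ip iq; rewrite ej in jp jq.
have kl : k != l.
  by apply: contra ij => /eqP kl; apply/eqP/phi_inj; rewrite ei ej kl.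
by case: pq; apply: ig; apply: (lines_meet lines1_distinct kl).
Qed.

(** The conic has two points in common with [L1] and with [L4], and at least one of
two curves with two common points must go to the conic. *)
Lemma phi_conic : phi None = None.
Proof.
have [c1 c2] := node_conic; have [l1 l2] := node_L1.
have [p [q [pq cp cq [lp lq]]]] := L4_conic.
have [//|h1] := two_points_conic (isT : None != Some ord0) (@nodes_neq R) c1 c2 l1 l2.
have [//|h2] := two_points_conic (isT : None != Some (inord 3)) pq cp cq lp lq.
have := phi_inj (etrans h1 (esym h2)) => -[] /(congr1 val) /=; by rewrite inordK.
Qed.

Lemma phi_onto m : exists j, m = phi j.
Proof. exact/codomP/(injF_onto phi_inj). Qed.

(** The image of [L1] meets the conic in the images of the nodes, two points on no
other component; a tangent line has just one point on the conic and the points of the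
other secants lie on a third component. *)
Lemma phi_L1 : phi (Some ord0) = Some ord0.
Proof.
case e: (phi (Some ord0)) => [k|]; last by have := phi_inj (etrans e (esym phi_conic)).
have [/(gphi None _) c1 /(gphi None _) c2] := node_conic; have [/gphi l1 /gphi l2] := node_L1.
rewrite phi_conic in c1 c2; rewrite e in l1 l2.
have gnodes : g (node1 R) <> g (node2 R) by move=> /ig; exact: nodes_neq.
have off j : j != k -> ~ component lines1 (Some j) (g (node1 R)).
  move=> jk; have [i ei] := phi_onto (Some j); rewrite ei => /gphi.
  case: i ei => [i|] ei; last by rewrite phi_conic in ei.
  apply: (proj1 (node_off _)); apply: contra jk => /eqP i0.
  by rewrite i0 e in ei; case: ei => ->.
have [k0|k0] := eqVneq (val k) 0%N; first by congr Some; apply/val_inj.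
have [k2|k2] := leqP (val k) 2.
  case: gnodes; apply: (@conic_tangent _ _ k) => //.
  by case: (val k) k0 k2 => [|[|[|]]].
by have [j jk] := conic_secant k2 c1 l1; move/(off j jk).
Qed.

Lemma off_branch_lines_image (p : CP2 R) : (forall k : 'I_7, k != ord0 ->
  ~ component lines2 (Some k) p) -> off_branch_lines (g p).
Proof.
move=> off k k0; have [j ej] := phi_onto (Some k); rewrite ej => /gphi.
case: j ej => [j|] ej; last by rewrite phi_conic in ej.
apply: off; apply: contra k0 => /eqP j0; by rewrite j0 phi_L1 in ej; case: ej => ->.
Qed.

(** The image under [g] of [disc] lies off the branch lines, so the roots on the conic
and on [L1] compare with the same sign at the images of the nodes. As [g] permutes the
nodes, this contradicts [nodes_sign]. *)
Lemma no_component_preserving_map : False.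
Proof.
have i0 : 0 <= (0 : R) <= 1 by lra. have i1 : 0 <= (1 : R) <= 1 by lra.
have off p : unit_square p -> off_branch_lines (g (disc p)).
  by move=> sp; apply: off_branch_lines_image => k k0; exact: disc_avoids.
have sq (a b : R) : 0 <= a <= 1 -> 0 <= b <= 1 -> unit_square (a, b) by [].
have cgd p (sp : unit_square p) : {for p, continuous (fun p => g (disc p))}.
  exact: (continuous_comp (disc_continuous sp) (@cg (disc p))).
have cl (a t : R) : {for t, continuous (fun t : R => (a, t) : R * R)}.
  exact: (cvg_pair (@cst_continuous _ _ a t) (@cvg_id _ (nbhs t))).
have cc (a t : R) : {for t, continuous (fun t : R => (t, a) : R * R)}.
  exact: (cvg_pair (@cvg_id _ (nbhs t)) (@cst_continuous _ _ a t)).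
have con t : 0 <= t <= 1 -> conic R (g (disc (1, t))).
  move=> t01; have := gphi None (disc (1, t)); rewrite phi_conic => h; apply/h.
  by rewrite disc_top //; apply: conic_point_on_conic; exact: param_nonzero.
have lin t : 0 <= t <= 1 -> component lines1 (Some ord0) (g (disc (t, 1))).
  by move=> t01; have := gphi (Some ord0) (disc (t, 1)); rewrite phi_L1 => h; apply/h;
    exact: disc_right.
have x_off p : unit_square p -> exists x y z, g (disc p) = pt x y z /\ x != 0.
  by move=> /off/off_branch_lines_pt[x [y [z [n e [x0 _ _ _ _]]]]]; exists x, y, z.
pose psi p := descend (@branch R) (g (disc p)).
pose G1 t := descend (@conic_root R) (g (disc (1, t))).
pose G2 t := descend (@line_root R) (g (disc (t, 1))).
have := @square_monodromy R psi (descend (@branch R) (g (node1 R))) G1 G2.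
have c1 p : unit_square p -> {for p, continuous psi}.
  move=> sp; have [x [y [z [e x0]]]] := x_off p sp.
  have := @branch_continuous R x y z x0; rewrite -e => cb.
  exact: (continuous_comp (cgd p sp) cb).
have c2 t : 0 <= t <= 1 -> {for t, continuous G1}.
  move=> t01; have [x [y [z [e x0]]]] := x_off _ (sq 1 t i1 t01).
  have := @conic_root_continuous R x y z x0; rewrite -e => cb.
  exact: (continuous_comp (cl 1 t) (continuous_comp (cgd _ (sq 1 t i1 t01)) cb)).
have c3 t : 0 <= t <= 1 -> {for t, continuous G2}.
  move=> t01; have [x [y [z [e x0]]]] := x_off _ (sq t 1 t01 i1).
  have := @line_root_continuous R x y z x0; rewrite -e => cb.
  exact: (continuous_comp (cc 1 t) (continuous_comp (cgd _ (sq t 1 t01 i1)) cb)).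
have n0 p : unit_square p -> psi p != 0.
  by move=> sp; apply: branch_neq0; exact: off.
have k0 t : 0 <= t <= 1 ->
    psi (0, t) = descend (@branch R) (g (node1 R)) /\
    psi (t, 0) = descend (@branch R) (g (node1 R)).
  rewrite /psi; by move=> t01; have [-> ->] := disc_left t01.
have r1 t : 0 <= t <= 1 -> 0 < G1 t ^+ 2 / psi (1, t).
  by move=> t01; apply: conic_root_branch; [apply: off; exact: sq|exact: con].
have r2 t : 0 <= t <= 1 -> 0 < G2 t ^+ 2 / psi (t, 1).
  by move=> t01; apply: line_root_branch; [apply: off; exact: sq|exact: lin].
move=> /(_ c1 n0 k0 c2 c3 r1 r2).
rewrite /G1 /G2 disc_corner (proj2 (disc_left i1)) (proj1 (disc_left i1)) invfM mulrACA.
have [/(gphi None _) cn1 /(gphi None _) cn2] := node_conic; have [/gphi l1 /gphi l2] := node_L1.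
rewrite phi_conic in cn1 cn2; rewrite phi_L1 in l1 l2.
have gnodes : g (node1 R) <> g (node2 R) by move=> /ig; exact: nodes_neq.
have := @nodes_sign R; move: gnodes.
have [-> | ->] := conic_L1_nodes cn1 l1; have [-> | ->] := conic_L1_nodes cn2 l2 => // _ s1 s2.
  by have := lt_trans s1 s2; rewrite ltxx.
by have := lt_trans s1 s2; rewrite mulrC ltxx.
Qed.
End Contradiction.

Unset Implicit Arguments.

Theorem theorem2p9 (R : realType) :
  ~ exists h : CP2 R -> CP2 R,
      homeomorphism h /\
      h @` (conic_line R `|` B1 R) = conic_line R `|` B2 R.
Proof.
move=> [h [[g [hg gh ch cg]] hK]].
have U p : (exists j, component lines2 j p) <-> (exists j, component lines1 j (g p)).
  split=> Kp.
    have : [set p | exists j, component lines2 j p] p by [].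
    by rewrite -arrangement2_components -hK arrangement1_components => -[q Kq <-]; rewrite hg.
  have : (h @` (conic_line R `|` B1 R)) p by exists (g p); rewrite ?arrangement1_components.
  by rewrite hK arrangement2_components.
have [phi phiP] := choice (component_image lines2_distinct lines1_distinct cg ch hg gh U).
exact: (no_component_preserving_map cg (can_inj gh) phiP).
Qed.
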